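(* Assume $T$ is $\mathrm{NTP}_2$ and $A$ is an extension base. If $a\downarrow^{ist}_A b$ then $b\downarrow^{st}_A a$.
   Context: $T$ is a complete first-order theory; work in a monster model. $T$ has the tree property of the second kind if there are a formula $\varphi(x,y)$, $k<\omega$ and an array $\langle a_{i,j}:i,j<\omega\rangle$ such that each row $\{\varphi(x,a_{i,j}):j<\omega\}$ is $k$-inconsistent and every path $\{\varphi(x,a_{i,\eta(i)}):i<\omega\}$ ($\eta:\omega\to\omega$) is consistent; $\mathrm{NTP}_2$ means it does not. $A$ is an extension base if no type over $A$ forks over $A$. A type $\operatorname{tp}(e/C)$, $A\subseteq C$, splits strongly over $A$ if there are $c_1,c_2\in C$ and a formula $\psi(x,y)$ over $A$ with $\psi(x,c_1)\wedge\neg\psi(x,c_2)\in\operatorname{tp}(e/C)$ such that $c_1,c_2$ lie in a common $A$-indiscernible sequence. $a\downarrow^{ist}_A b$ means there is a global type $p\supseteq\operatorname{tp}(a/Ab)$ which does not split strongly over $A$ such that for every set $D\supseteq Ab$ and every $c\models p|_D$, $\operatorname{tp}(D/Ac)$ does not divide over $A$. $b\downarrow^{st}_A a$ means there is a global type $q\supseteq\operatorname{tp}(b/Aa)$ which does not fork over $A$ such that for every set $D\supseteq Aa$ and every $c\models q|_D$, $\operatorname{tp}(D/Ac)$ does not divide over $A$. *)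

(* Defs.v *)
From mathcomp Require Import all_boot all_classical.

Set Implicit Arguments.
Unset Strict Implicit.
Unset Printing Implicit Defensive.

Local Open Scope classical_set_scope.
Local Open Scope card_scope.

(** * First-order syntax and semantics *)

Record language := Language {
  fun_sym : Type;
  fun_ar : fun_sym -> nat;
  rel_sym : Type;
  rel_ar : rel_sym -> nat }.

Inductive term (L : language) (V : Type) : Type :=
| Var of V
| App (f : fun_sym L) of ('I_(fun_ar f) -> term L V).

(* [formula L V]: formulas whose free variables are among [V]. A quantifier
   binds the extra point [None] of [option V]. *)
Inductive formula (L : language) (V : Type) : Type :=
| Bot
| Eq of term L V & term L V
| Rel (r : rel_sym L) of ('I_(rel_ar r) -> term L V)
| Imp of formula L V & formula L V
| All of formula L (option V).

Arguments Bot {L V}.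
Arguments App {L V} f _.
Arguments Rel {L V} r _.

Definition Not (L : language) V (phi : formula L V) : formula L V :=
  Imp phi Bot.

Definition And (L : language) V (phi psi : formula L V) : formula L V :=
  Not (Imp phi (Not psi)).

Fixpoint rename_term (L : language) V W (f : V -> W) (t : term L V) :
    term L W :=
  match t with
  | Var x => Var L (f x)
  | App g ts => App g (fun i => rename_term f (ts i))
  end.

Fixpoint rename (L : language) V W (f : V -> W) (phi : formula L V) :
    formula L W :=
  match phi with
  | Bot => Bot
  | Eq s t => Eq (rename_term f s) (rename_term f t)
  | Rel r ts => Rel r (fun i => rename_term f (ts i))
  | Imp phi psi => Imp (rename f phi) (rename f psi)
  | All phi => All (rename (omap f) phi)
  end.

Record structure (L : language) := Structure {
  carrier :> Type;
  fun_interp : forall f : fun_sym L, ('I_(fun_ar f) -> carrier) -> carrier;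
  rel_interp : forall r : rel_sym L, ('I_(rel_ar r) -> carrier) -> Prop;
  carrier_inhabited : inhabited carrier }.

Arguments fun_interp {L} s f _.
Arguments rel_interp {L} s r _.

Fixpoint eval (L : language) (M : structure L) V (v : V -> M) (t : term L V) :
    M :=
  match t with
  | Var x => v x
  | App f ts => fun_interp M f (fun i => eval v (ts i))
  end.

Fixpoint sat (L : language) (M : structure L) V (v : V -> M)
    (phi : formula L V) : Prop :=
  match phi with
  | Bot => False
  | Eq s t => eval v s = eval v t
  | Rel r ts => rel_interp M r (fun i => eval v (ts i))
  | Imp phi psi => sat v phi -> sat v psi
  | All phi =>
      forall x : M, sat (fun o => if o is Some y then v y else x) phi
  end.

(** * Complete theories *)

Definition sentence (L : language) : Type := formula L void.

Definition models (L : language) (M : structure L) (T : set (sentence L)) :=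
  forall sigma, T sigma -> sat (of_void M) sigma.

Definition theory_entails (L : language) (T : set (sentence L))
    (sigma : sentence L) :=
  forall M : structure L, models M T -> sat (of_void M) sigma.

Definition complete_theory (L : language) (T : set (sentence L)) :=
  (exists M : structure L, models M T) /\
  forall sigma, theory_entails T sigma \/ theory_entails T (Not sigma).

Section InStructure.
Context (L : language) (M : structure L).

(** * Formulas with parameters and types

   A tuple indexed by [I] is a function [I -> M]. An L(M)-formula in variables
   [I] is a [formula L (I + M)], each [m : M] being a name for itself. *)

Definition join I J (v : I -> M) (w : J -> M) : I + J -> M :=
  fun z => match z with inl i => v i | inr j => w j end.

(* The L(M)-formula phi(x, d) obtained from phi(x, y). *)
Definition inst I J (phi : formula L (I + J)) (d : J -> M) :
    formula L (I + M) :=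
  rename (fun z => match z with inl i => inl i | inr j => inr (d j) end) phi.

Definition holds I (c : I -> M) (theta : formula L (I + M)) : Prop :=
  sat (join c id) theta.

(* The L(C)-formulas in variables [I]. *)
Definition over I (C : set M) : set (formula L (I + M)) :=
  [set theta | exists psi : formula L (I + C), theta = inst psi val].

Definition tp I (c : I -> M) (C : set M) : set (formula L (I + M)) :=
  [set theta | over C theta /\ holds c theta].

Definition realizes I (c : I -> M) (p : set (formula L (I + M))) : Prop :=
  forall theta, p theta -> holds c theta.

(* Some finite part of [p] implies [S] in [M]. *)
Definition implies I (p : set (formula L (I + M))) (S : set (I -> M)) : Prop :=
  exists (n : nat) (theta : 'I_n -> formula L (I + M)),
    (forall i, p (theta i)) /\
    forall c : I -> M, (forall i, holds c (theta i)) -> S c.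

Definition consistent I (p : set (formula L (I + M))) : Prop :=
  ~ implies p set0.

Definition complete_type I (C : set M) (p : set (formula L (I + M))) : Prop :=
  [/\ p `<=` over C, consistent p &
      forall theta, over C theta -> p theta \/ p (Not theta)].

Definition global_type I (p : set (formula L (I + M))) : Prop :=
  complete_type setT p.

Definition type_restr I (p : set (formula L (I + M))) (D : set M) :
    set (formula L (I + M)) :=
  p `&` over D.

(** * Monster models: [K] is a set of the cardinality kappa of the monster. *)

Definition card_lt X Y (A : set X) (B : set Y) : Prop :=
  A #<= B /\ ~ (B #<= A).

Definition small (K : Type) X (A : set X) : Prop := card_lt A [set: K].

Definition saturated (K : Type) : Prop :=
  forall (C : set M) (p : set (formula L (unit + M))),
    small K C -> complete_type C p -> exists c, realizes c p.

Definition elementary_on (X : set M) (f : M -> M) : Prop :=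
  forall phi : formula L X, sat (val : X -> M) phi <-> sat (f \o val) phi.

Definition automorphism (s : M -> M) : Prop :=
  [/\ bijective s,
      forall f a, s (fun_interp M f a) = fun_interp M f (s \o a) &
      forall r a, rel_interp M r a <-> rel_interp M r (s \o a)].

Definition strongly_homogeneous (K : Type) : Prop :=
  forall (X : set M) (f : M -> M), small K X -> elementary_on X f ->
    exists2 s, automorphism s & forall x, X x -> s x = f x.

(* kappa > |T|, where |T| is the number of L-formulas, so that kappa is
   uncountable. *)
Definition monster_model (K : Type) (T : set (sentence L)) : Prop :=
  [/\ models M T, small K [set: formula L nat],
      saturated K & strongly_homogeneous K].

(** * Dividing and forking *)

Definition k_inconsistent I (k : nat) (theta : nat -> formula L (I + M)) :
    Prop :=
  forall s : 'I_k -> nat, injective s ->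
    ~ exists c : I -> M, forall i, holds c (theta (s i)).

Definition formula_divides I (A : set M) (theta : formula L (I + M)) : Prop :=
  exists (m : nat) (phi : formula L (I + 'I_m)) (d : 'I_m -> M),
    theta = inst phi d /\
    exists (k : nat) (ds : nat -> 'I_m -> M),
      (forall i, tp (ds i) A = tp d A) /\
      k_inconsistent k (fun i => inst phi (ds i)).

Definition divides I (A : set M) (p : set (formula L (I + M))) : Prop :=
  exists2 theta, formula_divides A theta & implies p [set c | holds c theta].

Definition forks I (A : set M) (p : set (formula L (I + M))) : Prop :=
  exists (n : nat) (theta : 'I_n -> formula L (I + M)),
    (forall i, formula_divides A (theta i)) /\
    implies p [set c | exists i, holds c (theta i)].

Definition extension_base (A : set M) : Prop :=
  forall (n : nat) (p : set (formula L ('I_n + M))),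
    complete_type A p -> ~ forks A p.

(** * The tree property of the second kind *)

Definition TP2 : Prop :=
  exists (n m : nat) (phi : formula L ('I_n + 'I_m)) (k : nat)
         (a : nat -> nat -> 'I_m -> M),
    (forall i, k_inconsistent k (fun j => inst phi (a i j))) /\
    forall eta : nat -> nat,
      consistent (range (fun i => inst phi (a i (eta i)))).

Definition NTP2 : Prop := ~ TP2.

(** * Strong splitting *)

Definition indiscernible m (A : set M) (c : nat -> 'I_m -> M) : Prop :=
  forall (n : nat) (s t : 'I_n -> nat),
    {homo s : i j / (i < j)%N} -> {homo t : i j / (i < j)%N} ->
    tp (fun z : 'I_n * 'I_m => c (s z.1) z.2) A =
    tp (fun z : 'I_n * 'I_m => c (t z.1) z.2) A.

(* [p] is a complete type over [C]; psi(x, y) is over [A], with [y] indexed by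
   ['I_m]. *)
Definition splits_strongly I (A C : set M) (p : set (formula L (I + M))) :
    Prop :=
  exists (m : nat) (psi : formula L (I + ('I_m + A))) (c1 c2 : 'I_m -> M),
    [/\ range c1 `<=` C, range c2 `<=` C,
        p (And (inst psi (join c1 val)) (Not (inst psi (join c2 val)))) &
        exists c : nat -> 'I_m -> M,
          indiscernible A c /\ exists i j, c i = c1 /\ c j = c2].

(** * The independence relations

   In [tp D (A `|` range c)], the set [D] is the tuple enumerated by itself. *)

Definition ist (K : Type) I J (A : set M) (a : I -> M) (b : J -> M) : Prop :=
  exists p : set (formula L (I + M)),
    [/\ global_type p, tp a (A `|` range b) `<=` p,
        ~ splits_strongly A setT p &
        forall D : set M, small K D -> A `|` range b `<=` D ->
          forall c : I -> M, realizes c (type_restr p D) ->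
            ~ divides A (tp (val : D -> M) (A `|` range c))].

Definition st (K : Type) I J (A : set M) (b : J -> M) (a : I -> M) : Prop :=
  exists q : set (formula L (J + M)),
    [/\ global_type q, tp b (A `|` range a) `<=` q,
        ~ forks A q &
        forall D : set M, small K D -> A `|` range a `<=` D ->
          forall c : J -> M, realizes c (type_restr q D) ->
            ~ divides A (tp (val : D -> M) (A `|` range c))].

End InStructure.

Arguments small K {X} A.
Arguments saturated {L} M K.
Arguments strongly_homogeneous {L} M K.
Arguments monster_model {L} M K T.
Arguments TP2 {L} M.
Arguments NTP2 {L} M.

(* Main.v *)
(* Types are handled as ultrafilters on the tuples of the monster model, and
   parameters as tuples moved by automorphisms. Two facts carry the proof.

   Over an extension base A of an NTP2 theory, a finite disjunction of formulas
   dividing over A divides along an A-indiscernible sequence. First one passes to a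
   small model N containing A, chosen (as A is an extension base) so that the formulas
   still divide over N. By NTP2 a formula dividing over N is made inconsistent by a
   sequence realizing a product of coheirs; hence (broom lemma) a disjunction of such
   formulas is inconsistent along finitely many conjugates, so there is a coheir q of
   the type over N such that tp(D/Nc) contains no dividing formula for c realizing q
   over D. By NTP2 again, the Morley sequences of q are witnesses for every formula
   dividing over N (Kim's lemma).

   If b is not st-independent from a, compactness gives theta(x,a) in tp(b/Aa) implying
   phi(x,d) \/ chi(d,x), where phi(x,d) and chi(y,b) are finite disjunctions of formulas
   dividing over A. Take indiscernible witnesses (e_j) = (a_j d_j) for phi and (b_i) for
   chi, with b_0 = b, and c realizing the given global extension of tp(a/Ab) over all
   b_i. Since the extension does not split strongly, theta(b_i,c) holds for all i; since
   tp((b_i)/Ac) does not divide, there is a copy (x_i) of (b_i) with theta(x_i,a_j) for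
   all i and enough j. So each x_i satisfies phi(x,d_j) for all these j, which is
   impossible, or chi(d_j,x) for one of them; by pigeonhole some d_j satisfies chi(y,x_i)
   for too many i. *)

Require Import Defs.
From mathcomp Require Import all_boot all_classical.
From Stdlib Require List.

Set Implicit Arguments.
Unset Strict Implicit.
Unset Printing Implicit Defensive.

Local Open Scope classical_set_scope.
Local Open Scope card_scope.

(** * Cardinal arithmetic *)

Definition emb (X Y : Type) : Prop := exists f : X -> Y, injective f.

Lemma emb_trans X Y Z : emb X Y -> emb Y Z -> emb X Z.
Proof. by move=> [f fi] [g gi]; exists (g \o f); apply: inj_comp. Qed.

Lemma emb_card X Y (A : set X) (B : set Y) : A #<= B <-> emb A B.
Proof.
split=> [/card_leP/injfunPex [f _ fi]|[f fi]].
  by exists f => x y; apply: fi; apply: in_setT.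
by apply/card_leP/injfunPex; exists f => // x y _ _; apply: fi.
Qed.

Lemma emb_surj X Y (f : X -> Y) : (forall y, exists x, f x = y) -> emb Y X.
Proof.
move=> /choice[g gK]; exists g => y y' e.
by rewrite -(gK y) -(gK y') e.
Qed.

(** A maximal graph of a partial injection, given by Zorn, exhausts one of the two types; otherwise
    one more pair could be added. *)
Lemma emb_total X Y : emb X Y \/ emb Y X.
Proof.
pose P (G : set (X * Y)) := forall p q, G p -> G q -> (p.1 = q.1 <-> p.2 = q.2).
have [G [PG maxG]] : exists G, P G /\ forall B, G `<` B -> ~ P B.
  apply: Zorn_bigcup => F FP tot p q [A FA Ap] [B FB Bq].
  by have [AB|BA] := tot _ _ FA FB;
    [apply: (FP _ FB) => //; apply: AB | apply: (FP _ FA) => //; apply: BA].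
have [/choice[f Gf]|nX] := pselect (forall x, exists y, G (x, y)).
  by left; exists f => x x' e; have [_ h] := PG _ _ (Gf x) (Gf x'); apply: h.
have [/choice[f Gf]|nY] := pselect (forall y, exists x, G (x, y)).
  by right; exists f => y y' e; have [h _] := PG _ _ (Gf y) (Gf y'); apply: h.
have [x nx] : exists x, ~ exists y, G (x, y) by apply/existsNP.
have [y ny] : exists y, ~ exists x, G (x, y) by apply/existsNP.
exfalso; apply: (maxG (G `|` [set (x, y)])).
  split; first by move=> p; left.
  by move=> /(_ (x, y) (or_intror erefl)) Gxy; apply: nx; exists y.
move=> p q [Gp|->] [Gq|->] //=; first exact: PG.
- split=> e; first by case: nx; exists p.2; rewrite -e -surjective_pairing.
  by case: ny; exists p.1; rewrite -e -surjective_pairing.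
- split=> e; first by case: nx; exists q.2; rewrite e -surjective_pairing.
  by case: ny; exists q.1; rewrite e -surjective_pairing.
Qed.

(* [G] is the graph of an injection A * A -> A, where A is the set of first coordinates
   of the arguments. *)
Definition square_graph Z (G : set (Z * Z * Z)) : Prop :=
  let A := [set z | exists p, G p /\ p.1.1 = z] in
  [/\ forall p q, G p -> G q -> (p.1 = q.1 <-> p.2 = q.2),
      forall x y, A x -> A y -> exists z, G (x, y, z) &
      forall p, G p -> A p.1.2 /\ A p.2].

Lemma emb_bool_square Z (x y : Z) : x <> y -> emb (Z + Z) (Z * Z).
Proof.
move=> xy; exists (fun z => match z with inl z => (x, z) | inr z => (y, z) end).
move=> [a|a] [b|b] e; have := congr1 fst e; have := congr1 snd e => /= e1 e2.
- by rewrite e1.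
- by case: xy.
- by case: xy.
- by rewrite e1.
Qed.

Lemma emb_sum X Y X' Y' : emb X X' -> emb Y Y' -> emb (X + Y) (X' + Y').
Proof.
move=> [f fi] [g gi].
exists (fun z => match z with inl z => inl (f z) | inr z => inr (g z) end).
by move=> [a|a] [b|b] // [e]; rewrite ?(fi _ _ e) ?(gi _ _ e).
Qed.

Lemma emb_prod X Y X' Y' : emb X X' -> emb Y Y' -> emb (X * Y) (X' * Y').
Proof.
move=> [f fi] [g gi]; exists (fun z => (f z.1, g z.2)).
by move=> [a b] [a' b'] [] /= /fi-> /gi->.
Qed.

Lemma square_graph_inj Z (G : set (Z * Z * Z))
    (A := [set z | exists p, G p /\ p.1.1 = z]) : square_graph G ->
  exists2 f : A * A -> A, injective f & forall p, G (val p.1, val p.2, val (f p)).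
Proof.
move=> [inj tot ran].
have /choice[f Gf] : forall p : A * A, exists z : A, G (val p.1, val p.2, val z).
  move=> [x y]; have [z Gz] := tot (val x) (val y) (set_valP x) (set_valP y).
  by have [_ Az] := ran _ Gz; exists (SigSub (mem_set Az)).
exists f => // -[x y] [x' y'] e.
have [_ /(_ (congr1 val e)) []] := inj _ _ (Gf (x, y)) (Gf (x', y')).
by move=> /= /val_inj-> /val_inj->.
Qed.

Lemma square_graphP Z (A : set Z) (f : A * A -> A) : injective f ->
  let G := [set p | exists q : A * A, p = (val q.1, val q.2, val (f q))] in
  square_graph G /\ [set z | exists p, G p /\ p.1.1 = z] = A.
Proof.
move=> fi G; have -> : [set z | exists p, G p /\ p.1.1 = z] = A.
  apply/seteqP; split=> [z [p [[q ->] <-]]|z Az]; first exact: set_valP.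
  pose z' : A := SigSub (mem_set Az).
  by exists (z, z, val (f (z', z'))); split=> //; exists (z', z').
split=> //; rewrite /square_graph.
have -> : [set z | exists p, G p /\ p.1.1 = z] = A.
  apply/seteqP; split=> [z [p [[q ->] <-]]|z Az]; first exact: set_valP.
  pose z' : A := SigSub (mem_set Az).
  by exists (z, z, val (f (z', z'))); split=> //; exists (z', z').
split.
- move=> p q [[x y] ->] [[x' y'] ->] /=; split; last by move=> /val_inj/fi [-> ->].
  by move=> [] /val_inj-> /val_inj->.
- move=> x y Ax Ay; pose x' : A := SigSub (mem_set Ax); pose y' : A := SigSub (mem_set Ay).
  by exists (val (f (x', y'))); exists (x', y').
- by move=> p [q ->]; split; apply: set_valP.
Qed.

(** A maximal injection [A * A -> A] extending one on a copy of [nat] is taken. Either the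
    complement of [A] embeds in [A], and then [Z] embeds in [A + A], hence in [A]; or [A] embeds in
    its complement and the injection can be extended, against maximality. *)
Lemma emb_square Z : emb nat Z -> emb (Z * Z) Z.
Proof.
move=> [n0 n0i].
pose N : set Z := range n0.
have [e ei] : exists e : N * N -> N, injective e.
  have eN : emb N nat.
    suff /choice[r rP] : forall z : N, exists n, n0 n = val z.
      by exists r => x y xy; apply: val_inj; rewrite -!rP xy.
    by move=> z; have [n _ <-] := set_valP z; exists n.
  apply: emb_trans (emb_prod eN eN) _; apply: emb_trans (_ : emb nat N).
    by exists (fun p => pickle p); apply: (pcan_inj pickleK).
  exists (fun n => SigSub (mem_set (imageT n0 n))).
  by move=> x y /(congr1 val) /n0i.
have [] := square_graphP ei.
set G0 : set (Z * Z * Z) := [set p | _] => sG0 G0N.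
have [G [sG maxG]] : exists G, square_graph (G0 `|` G) /\
    forall B, G `<` B -> ~ square_graph (G0 `|` B).
  apply: (@Zorn_bigcup _ (fun G => square_graph (G0 `|` G))) => F FP tot.
  have [[A0 FA0]|F0] := pselect (F !=set0); last first.
    rewrite (_ : \bigcup_(X in F) X = set0) ?setU0//.
    by apply/seteqP; split=> // x [A FA _]; case: F0; exists A.
  have com p q : (G0 `|` \bigcup_(X in F) X) p -> (G0 `|` \bigcup_(X in F) X) q ->
      exists2 A, F A & (G0 `|` A) p /\ (G0 `|` A) q.
    move=> [Gp|[A FA Ap]] [Gq|[B FB Bq]].
    - by exists A0 => //; split; left.
    - by exists B => //; split; [left|right].
    - by exists A => //; split; [right|left].
    - have [AB|BA] := tot _ _ FA FB.
        by exists B => //; split; right => //; apply: AB.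
      by exists A => //; split; right => //; apply: BA.
  have sub A : F A -> G0 `|` A `<=` G0 `|` \bigcup_(X in F) X.
    by move=> FA p [?|?]; [left|right; exists A].
  split.
  - by move=> p q /com h /h [A FA [Ap Aq]]; have [+ _ _] := FP _ FA; apply.
  - move=> x y [p [Gp px]] [q [Gq qy]]; have [A FA [Ap Aq]] := com _ _ Gp Gq.
    have [_ + _] := FP _ FA; move=> /(_ x y) []; [by exists p|by exists q|].
    by move=> z Az; exists z; apply: sub Az.
  - move=> p Gp; have [A FA [Ap _]] := com _ _ Gp Gp.
    have [_ _ /(_ p Ap) [[q [Aq qe]] [r [Ar re]]]] := FP _ FA.
    by split; [exists q; split=> //; apply: sub Aq|exists r; split=> //; apply: sub Ar].
have [f fi Gf] := square_graph_inj sG.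
move: f fi Gf; set A := [set z | _] => f fi Gf.
have AN n : A (n0 n).
  have : N (n0 n) by exists n.
  by rewrite -G0N => -[p [Gp pe]]; exists p; split => //; left.
pose a0 : A := SigSub (mem_set (AN 0)); pose a1 : A := SigSub (mem_set (AN 1)).
have a01 : a0 <> a1 by move=> /(congr1 val) /n0i.
have eAA : emb (A * A) A by exists f.
have eAS : emb (A + A) A by apply: emb_trans (emb_bool_square a01) eAA.
have [[g gi]|eCA] := emb_total A (~` A); last first.
  have eZ : emb Z A.
    apply: emb_trans eAS; apply: emb_trans (emb_sum (_ : emb A A) eCA); last by exists id.
    exists (fun z => match pselect (A z) with
      left Az => inl (SigSub (mem_set Az)) | right nAz => inr (SigSub (mem_set (nAz : (~` A) z))) end).
    by move=> x y; case: pselect => Ax; case: pselect => Ay // [].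
  apply: emb_trans (emb_prod eZ eZ) _; apply: emb_trans eAA _.
  by exists val; apply: val_inj.
exfalso.
(* [C] is a copy of [A] outside [A]. The pairs of [B * B] that are not in [A * A] are sent
   injectively into [C], where no value of [f] lies. *)
pose C : set Z := range (val \o g); pose B := A `|` C.
have nC z : C z -> ~ A z by move=> [x _ <-]; apply: (set_valP (g x)).
have eB : emb B A.
  apply: emb_trans eAS.
  have /choice[r rP] : forall z : B, exists s : A + A,
      val z = match s with inl a => val a | inr a => val (g a) end.
    move=> z; case: (set_valP z) => [Az|[a _ ag]]; last by exists (inr a).
    by exists (inl (SigSub (mem_set Az))).
  by exists r => x y e'; apply: val_inj; rewrite (rP x) (rP y) e'.
have [h hi] := emb_trans (emb_prod eB eB) eAA.
have BA (z : A) : B (val z) by left; apply: set_valP.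
have BC (z : A) : B (val (g z)) by right; exists z.
pose f' (q : B * B) : B :=
  match pselect (A (val q.1)), pselect (A (val q.2)) with
  | left a1, left a2 => SigSub (mem_set (BA (f (SigSub (mem_set a1), SigSub (mem_set a2)))))
  | _, _ => SigSub (mem_set (BC (h q))) end.
have f'1 (q : B * B) (u v : A) : val q.1 = val u -> val q.2 = val v ->
    val (f' q) = val (f (u, v)).
  rewrite /f' => q1 q2; case: pselect => [a|]; last by rewrite q1; case; apply: set_valP.
  case: pselect => [b|]; last by rewrite q2; case; apply: set_valP.
  by rewrite /=; congr (val (f (_, _))); apply: val_inj.
have f'2 (q : B * B) : ~ (A (val q.1) /\ A (val q.2)) -> val (f' q) = val (g (h q)).
  by rewrite /f' => nq; case: pselect => // a; case: pselect => // b; case: nq.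
have f'i : injective f'.
  move=> p q /(congr1 val).
  have [[p1 p2]|np] := pselect (A (val p.1) /\ A (val p.2));
  have [[q1 q2]|nq] := pselect (A (val q.1) /\ A (val q.2)).
  - rewrite (f'1 _ (SigSub (mem_set p1)) (SigSub (mem_set p2))) //.
    rewrite (f'1 _ (SigSub (mem_set q1)) (SigSub (mem_set q2))) //.
    move=> /val_inj /fi [e1 e2]; case: p q {p1 p2 q1 q2} e1 e2 => [? ?] [? ?] /=.
    by move=> /val_inj-> /val_inj->.
  - rewrite (f'1 _ (SigSub (mem_set p1)) (SigSub (mem_set p2))) // f'2 // => e'.
    by have := set_valP (g (h q)); case; rewrite -e'; apply: set_valP.
  - rewrite f'2 // (f'1 _ (SigSub (mem_set q1)) (SigSub (mem_set q2))) // => e'.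
    by have := set_valP (g (h p)); case; rewrite e'; apply: set_valP.
  - by rewrite !f'2 // => /val_inj /gi /hi.
have [] := square_graphP f'i; set G' := [set p | _] => sG' G'B.
have sub : G0 `|` G `<=` G'.
  move=> p Gp; have [inj tot ran] := sG; have [Ap2 _] := ran _ Gp.
  have Ap1 : A p.1.1 by exists p.
  pose u : A := SigSub (mem_set Ap1); pose v : A := SigSub (mem_set Ap2).
  pose q : B * B := (SigSub (mem_set (BA u)), SigSub (mem_set (BA v))).
  exists q; rewrite (f'1 _ u v) //=.
  have [pE _] := inj _ _ Gp (Gf (u, v)).
  have p1 : p.1 = (val u, val v) by rewrite /= -surjective_pairing.
  by rewrite [p]surjective_pairing p1; congr (_, _); apply: pE.
apply: (maxG G').
  split; first by move=> p Gp; apply: sub; right.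
  move=> G'G; pose c : B := SigSub (mem_set (BC a0)).
  apply: (nC (val (g a0))); first by exists a0.
  exists (val c, val c, val (f' (c, c))); split=> //; right.
  by apply: G'G; exists (c, c).
by rewrite (_ : G0 `|` G' = G') //; apply/setUidPr => p Gp; apply: sub; left.
Qed.

Lemma emb_seq Z : emb nat Z -> emb (seq Z) Z.
Proof.
move=> eN; have [p pi] := emb_square eN.
have [n0 n0i] := eN.
apply: emb_trans (_ : emb (nat * Z) Z); last first.
  by apply: emb_trans (emb_prod eN (ex_intro _ id (fun _ _ => id))) (emb_square eN).
exists (fun s => (size s, foldr (fun x y => p (x, y)) (n0 0) s)).
elim=> [|x s IH] [|y t] // e.
have [st] := congr1 fst e; have /pi [-> tE] := congr1 snd e.
by congr (_ :: _); apply: IH; congr (_, _).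
Qed.

(** * Small sets *)

Section Small.
Context (K F : Type).
Hypotheses (F_inf : emb nat F) (F_small : small K [set: F]).

(** By comparability of cardinals this is smallness, as [smE] shows, in a form that passes along
    embeddings at once. *)
Definition sm (X : Type) : Prop := ~ emb K X.

Lemma smE X (A : set X) : small K A <-> sm A.
Proof.
rewrite /small /card_lt /sm !emb_card.
have eK : emb [set: K] K by exists val; apply: val_inj.
have Ke : emb K [set: K].
  by exists (fun x => SigSub (mem_set (I : [set: K] x))) => x y [].
split=> [[_ h] /(emb_trans eK)//|h]; split; last by move=> /(emb_trans Ke).
by have [/emb_trans|//] := emb_total A K; apply.
Qed.

Lemma sm_setT X : small K [set: X] <-> sm X.
Proof.
rewrite smE /sm; split=> h /emb_trans e; apply: h; apply: e.
  by exists (fun x => SigSub (mem_set (I : [set: X] x))) => x y [].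
by exists val; apply: val_inj.
Qed.

Lemma sm_emb X Y : emb X Y -> sm Y -> sm X.
Proof. by move=> XY nY /emb_trans /(_ XY). Qed.

Lemma sm_surj X Y (f : X -> Y) : (forall y, exists x, f x = y) -> sm X -> sm Y.
Proof. by move=> /emb_surj; apply: sm_emb. Qed.

Lemma smF : sm F.
Proof. exact/sm_setT. Qed.

Lemma sm_infinite_sum X Y : emb nat Y -> emb X Y -> sm Y -> sm (X + Y).
Proof.
move=> eN XY; apply: sm_emb; apply: emb_trans (emb_square eN).
have [n0 n0i] := eN.
apply: emb_trans (emb_bool_square (_ : n0 0 <> n0 1)); last by move/n0i.
by apply: emb_sum => //; exists id.
Qed.

Lemma sm_sumF X : sm X -> sm (X + F).
Proof.
move=> sX; have [XF|FX] := emb_total X F.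
  by apply: sm_infinite_sum => //; apply: smF.
apply: sm_emb (_ : sm (F + X)); last first.
  by apply: sm_infinite_sum => //; apply: emb_trans FX.
exists (fun z => match z with inl x => inr x | inr x => inl x end).
by move=> [x|x] [y|y] // [->].
Qed.

(** Adding [F] makes both summands infinite; the sum then embeds in the square of the larger one,
    hence in the larger one itself. *)
Lemma sm_sum X Y : sm X -> sm Y -> sm (X + Y).
Proof.
move=> sX sY.
have el Z : emb Z (Z + F) by exists inl => x y [].
have er Z : emb nat (Z + F) by apply: emb_trans F_inf _; exists inr => x y [].
apply: sm_emb (emb_sum (el X) (el Y)) _.
have [e|e] := emb_total (X + F) (Y + F).
  by apply: sm_infinite_sum => //; apply: sm_sumF.
apply: sm_emb (_ : sm ((Y + F) + (X + F))); last first.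
  by apply: sm_infinite_sum => //; apply: sm_sumF.
exists (fun z => match z with inl x => inr x | inr x => inl x end).
by move=> [x|x] [y|y] // [->].
Qed.

Lemma sm_prod X Y : sm X -> sm Y -> sm (X * Y).
Proof.
move=> sX sY; pose Z : Type := ((X + Y) + F)%type.
have eN : emb nat Z by apply: emb_trans F_inf _; exists inr => x y [].
apply: sm_emb (_ : sm Z); last by apply: sm_sumF; apply: sm_sum.
apply: emb_trans (emb_square eN).
by apply: emb_prod; [exists (fun x => inl (inl x)) | exists (fun x => inl (inr x))] => x y [].
Qed.

Lemma sm_nat : sm nat.
Proof. exact: sm_emb F_inf smF. Qed.

Lemma sm_range X Y (f : X -> Y) : sm X -> sm (range f).
Proof.
apply: (@sm_surj _ _ (fun x => SigSub (mem_set (imageT f x)))) => y.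
by have [x _ fx] := set_valP y; exists x; apply: val_inj.
Qed.

Lemma sm_subset X (A B : set X) : A `<=` B -> sm B -> sm A.
Proof.
move=> AB; apply: sm_emb.
exists (fun x : A => SigSub (mem_set (AB _ (set_valP x)))).
by move=> x y [] /val_inj.
Qed.

Lemma sm_union X (A B : set X) : sm A -> sm B -> sm (A `|` B : set X).
Proof.
move=> sA sB.
apply: (sm_subset (_ : _ `<=` range (fun z : A + B => match z with inl x => val x | inr x => val x end))).
  move=> x [Ax|Bx].
    by exists (inl (SigSub (mem_set Ax))).
  by exists (inr (SigSub (mem_set Bx))).
by apply: sm_range; apply: sm_sum.
Qed.

End Small.

(** * Definable sets of tuples *)

Notation "w \inl l" := (List.In w l) (at level 70, no associativity).

Definition pos V (l : seq V) (w : V) : nat := find (fun u => `[< u = w >]) l.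

Lemma nth_pos V (l : seq V) (w d : V) : w \inl l -> nth d l (pos l w) = w.
Proof.
elim: l => //= u l IH uw; rewrite /pos /=; case: asboolP => //= nuw.
by apply: IH; case: uw.
Qed.

Lemma pos_size V (l : seq V) (w : V) : w \inl l -> (pos l w < size l)%N.
Proof.
elim: l => //= u l IH uw; rewrite /pos /=; case: asboolP => //= nuw.
by rewrite ltnS; apply: IH; case: uw.
Qed.

Definition posI V (l : seq V) (w : V) : 'I_(size l).+1 := inord (pos l w).

Lemma nth_posI V T (l : seq V) (h : V -> T) (d : T) (w : V) :
  w \inl l -> nth d (map h l) (posI l w) = h w.
Proof.
move=> wl; rewrite /posI inordK; last by rewrite ltnS ltnW ?pos_size.
by rewrite (nth_map w) ?pos_size // nth_pos.
Qed.

Lemma inl_enum (X : finType) (x : X) : x \inl enum X.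
Proof.
have: x \in enum X by rewrite mem_enum.
by elim: (enum X) => //= y s IH; rewrite inE => /orP[/eqP->|/IH]; [left|right].
Qed.

Section Definable.
Context (L : language) (M : structure L).
Implicit Types C D : set M.

Lemma eval_rename V W (f : V -> W) (v : W -> M) (t : term L V) :
  eval v (rename_term f t) = eval (v \o f) t.
Proof. by elim: t => //= g ts IH; congr fun_interp; apply/funext => i; apply: IH. Qed.

Lemma sat_rename V W (f : V -> W) (v : W -> M) (phi : formula L V) :
  sat v (rename f phi) <-> sat (v \o f) phi.
Proof.
elim: phi W f v => //= {V}.
- by move=> V s t W f v; rewrite !eval_rename.
- move=> V r ts W f v; rewrite (_ : (fun i => eval v (rename_term f (ts i))) =
    (fun i => eval (v \o f) (ts i))) //.
  by apply/funext => i; apply: eval_rename.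
- by move=> V p IHp q IHq W f v; rewrite IHp IHq.
- move=> V p IH W f v; split=> h x; have := h x.
    by rewrite IH; congr sat; apply/funext => -[].
  by rewrite IH; congr sat; apply/funext => -[].
Qed.

Lemma eval_supp V (t : term L V) : exists l : seq V, forall v v' : V -> M,
  (forall w, w \inl l -> v w = v' w) -> eval v t = eval v' t.
Proof.
elim: t => [x|g ts /choice[l lP]].
  by exists [:: x] => v v' /(_ x) h; apply: h; left.
exists (List.flat_map l (enum 'I_(fun_ar g))) => v v' h /=.
congr fun_interp; apply/funext => i; apply: lP => w wl; apply: h.
by apply/List.in_flat_map; exists i; split=> //; apply: inl_enum.
Qed.

(** Variables range over arbitrary types, but formulas are finite. This reduces statements on
    infinite tuples to the finite tuples in the definitions of dividing, strong splitting and
    [TP2]. *)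
Lemma sat_supp V (phi : formula L V) : exists l : seq V, forall v v' : V -> M,
  (forall w, w \inl l -> v w = v' w) -> sat v phi <-> sat v' phi.
Proof.
elim: phi => {V}.
- by move=> V; exists [::].
- move=> V s t; have [l lP] := eval_supp s; have [k kP] := eval_supp t.
  exists (l ++ k) => v v' h /=; rewrite (lP v v') ?(kP v v') //;
  move=> w wl; apply: h; apply: List.in_or_app; by [right|left].
- move=> V r ts; have /choice[l lP] := fun i => eval_supp (ts i).
  exists (List.flat_map l (enum 'I_(rel_ar r))) => v v' h /=.
  rewrite (_ : (fun i => eval v (ts i)) = (fun i => eval v' (ts i))) //.
  apply/funext => i; apply: lP => w wl; apply: h.
  by apply/List.in_flat_map; exists i; split=> //; apply: inl_enum.
- move=> V p [l lP] q [k kP]; exists (l ++ k) => v v' h /=.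
  rewrite (lP v v') ?(kP v v') //;
  move=> w wl; apply: h; apply: List.in_or_app; by [right|left].
- move=> V p [l lP].
  exists (List.flat_map (fun o => if o is Some w then [:: w] else [::]) l) => v v' h.
  split=> /= s x; have := s x; apply: (iffLR (lP _ _ _)) => -[w|] // wl.
    by apply: h; apply/List.in_flat_map; exists (Some w); split=> //; left.
  by rewrite h //; apply/List.in_flat_map; exists (Some w); split=> //; left.
Qed.

Lemma sat_not V (v : V -> M) (phi : formula L V) : sat v (Not phi) <-> ~ sat v phi.
Proof. by []. Qed.

Lemma sat_and V (v : V -> M) (p q : formula L V) : sat v (And p q) <-> sat v p /\ sat v q.
Proof.
split=> [h|[hp hq] h]; last exact: h hp hq.
by apply: contrapT => n; apply: h => /= hp hq; apply: n.
Qed.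

Definition drop_I0 W (z : W + 'I_0) : W :=
  match z with inl w => w | inr i => False_rect _ (notF (ltn_ord i)) end.

Definition split_I W n (z : W + 'I_n.+1) : option (W + 'I_n) :=
  match z with inl w => Some (inl w) | inr i => omap inr (unlift ord0 i) end.

Fixpoint exN W n : formula L (W + 'I_n) -> formula L W :=
  match n with
  | 0 => rename (@drop_I0 W)
  | n'.+1 => fun phi => exN (Not (All (Not (rename (@split_I W n') phi))))
  end.

Lemma sat_exN W n (w : W -> M) (phi : formula L (W + 'I_n)) :
  sat w (exN phi) <-> exists z : 'I_n -> M, sat (join w z) phi.
Proof.
elim: n phi => [|n IH] phi /=.
  rewrite sat_rename; split=> [h|[z h]].
    exists (fun i : 'I_0 => False_rect _ (notF (ltn_ord i))); move: h; congr sat.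
    by apply/funext => -[//|[]].
  by move: h; congr sat; apply/funext => -[//|[]].
rewrite IH; split=> [[z]|[z h]].
  move=> /= /existsNP [x /contrapT]; rewrite sat_rename => h.
  exists (fun i => if unlift ord0 i is Some j then z j else x); move: h; congr sat.
  by apply/funext => -[//|i] /=; case: unlift.
exists (fun i => z (lift ord0 i)) => /= /(_ (z ord0)); apply; rewrite sat_rename.
move: h; congr sat; apply/funext => -[//|i] /=.
by case: unliftP => [j ->|->].
Qed.

(** Definability is a predicate on sets of tuples, so that formulas are obtained from closure
    properties rather than written out. *)
Definition dfn C I (S : set (I -> M)) : Prop :=
  exists psi : formula L (I + C), forall c, S c <-> sat (join c val) psi.

Lemma dfn_ext C I (S S' : set (I -> M)) : (forall c, S c <-> S' c) -> dfn C S -> dfn C S'.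
Proof. by move=> SS' [psi h]; exists psi => c; rewrite -SS'. Qed.

Lemma dfn_not C I (S : set (I -> M)) : dfn C S -> dfn C (fun c => ~ S c).
Proof. by move=> [psi h]; exists (Not psi) => c; rewrite sat_not -h. Qed.

Lemma dfn_and C I (S S' : set (I -> M)) : dfn C S -> dfn C S' -> dfn C (fun c => S c /\ S' c).
Proof.
by move=> [psi h] [psi' h']; exists (And psi psi') => c; rewrite sat_and -h -h'.
Qed.

Lemma dfn_imp C I (S S' : set (I -> M)) : dfn C S -> dfn C S' -> dfn C (fun c => S c -> S' c).
Proof. by move=> [psi h] [psi' h']; exists (Imp psi psi') => c /=; rewrite -h -h'. Qed.

Lemma dfn_or C I (S S' : set (I -> M)) : dfn C S -> dfn C S' -> dfn C (fun c => S c \/ S' c).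
Proof.
move=> /dfn_not h h'; apply: dfn_ext (dfn_imp h h') => c /=.
by split=> [k|[]//]; have [|/k] := pselect (S c); [left|right].
Qed.

Lemma dfn_cst C I (P : Prop) : dfn C (fun _ : I -> M => P).
Proof.
have [p|np] := pselect P; last by exists Bot.
by exists (Not Bot) => c; split=> //= _ [].
Qed.

Lemma dfn_forall_in C I X (l : seq X) (S : X -> set (I -> M)) :
  (forall x, x \inl l -> dfn C (S x)) -> dfn C (fun c => forall x, x \inl l -> S x c).
Proof.
elim: l => [|x l IH] h; first by apply: dfn_ext (dfn_cst C I True).
have h1 := h x (or_introl erefl).
have h2 := IH (fun y yl => h y (or_intror yl)).
apply: dfn_ext (dfn_and h1 h2) => c; split=> [[hx hl] y [<-|/hl]//|k].
by split=> [|y yl]; apply: k; [left|right].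
Qed.

Lemma dfn_exists_in C I X (l : seq X) (S : X -> set (I -> M)) :
  (forall x, x \inl l -> dfn C (S x)) -> dfn C (fun c => exists2 x, x \inl l & S x c).
Proof.
move=> h; have := @dfn_forall_in C I X l (fun x c => ~ S x c) (fun x xl => dfn_not (h x xl)).
move/dfn_not; apply: dfn_ext => c; split=> [k|[x xl Sx] /(_ x xl)//].
by apply: contrapT => n; apply: k => x xl Sx; apply: n; exists x.
Qed.

Lemma dfn_forall_fin C I (X : finType) (S : X -> set (I -> M)) :
  (forall x, dfn C (S x)) -> dfn C (fun c => forall x, S x c).
Proof.
move=> h; apply: dfn_ext (@dfn_forall_in C I X (enum X) S (fun x _ => h x)) => c.
by split=> // k x; apply: k; apply: inl_enum.
Qed.

Definition coordinatewise C I J (h : (J -> M) -> I -> M) : Prop :=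
  forall i, (exists j, forall c, h c i = c j) \/ (exists2 m, C m & forall c, h c i = m).

Lemma dfn_sub C I J (h : (J -> M) -> I -> M) (S : set (I -> M)) :
  coordinatewise C h -> dfn C S -> dfn C (fun c => S (h c)).
Proof.
move=> hh [psi psiP].
have /choice[f fP] : forall i, exists z : J + C, forall c, h c i = join c val z.
  move=> i; have [[j hj]|[m Cm hm]] := hh i; first by exists (inl j).
  by exists (inr (SigSub (mem_set Cm))).
exists (rename (fun z => match z with inl i => f i | inr x => inr x end) psi) => c.
rewrite psiP sat_rename.
suff -> : join (h c) val = join c val \o (fun z => match z with inl i => f i | inr x => inr x end) by [].
by apply/funext => -[i|x] //=; rewrite fP.
Qed.

Lemma dfn_mono C D I (S : set (I -> M)) : C `<=` D -> dfn C S -> dfn D S.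
Proof.
move=> CD [psi psiP].
exists (rename (fun z => match z with inl i => inl i
  | inr x => inr (SigSub (mem_set (CD _ (set_valP x)))) end) psi) => c.
rewrite psiP sat_rename; set v := join _ _; set w := _ \o _.
by suff -> : v = w by []; apply/funext => -[].
Qed.

Lemma dfn_eq C I (i j : I) : dfn C (fun c : I -> M => c i = c j).
Proof. by exists (Eq (Var L (inl i)) (Var L (inl j))). Qed.

Lemma dfn_eq_cst C I (i : I) (m : M) : C m -> dfn C (fun c : I -> M => c i = m).
Proof. by move=> Cm; exists (Eq (Var L (inl i)) (Var L (inr (SigSub (mem_set Cm))))). Qed.

Lemma dfn_supp C I (S : set (I -> M)) : dfn C S ->
  exists l : seq I, forall c c', (forall i, i \inl l -> c i = c' i) -> S c <-> S c'.
Proof.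
move=> [psi psiP]; have [l lP] := sat_supp psi.
exists (List.flat_map (fun z => if z is inl i then [:: i] else [::]) l) => c c' h.
rewrite !psiP; apply: lP => -[i|x] //= il; apply: h.
by apply/List.in_flat_map; exists (inl i); split=> //; left.
Qed.

(** [V] may be infinite: only the variables in the support of the formula are quantified, each
    numbered by its position in that list. *)
Lemma dfn_ex C I V (S : set (I + V -> M)) :
  dfn C S -> dfn C (fun c : I -> M => exists v, S (join c v)).
Proof.
move=> [psi psiP]; have [l lP] := sat_supp psi; have [m0] := carrier_inhabited M.
pose f (z : (I + V) + C) : (I + C) + 'I_(size l).+1 := match z with
  | inl (inl i) => inl (inl i)
  | inl (inr _) => inr (posI l z)
  | inr x => inl (inr x) end.
exists (exN (rename f psi)) => c; rewrite sat_exN; split=> [[v]|[z]].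
  move=> /psiP h; pose g := join (join c v) (val : C -> M).
  exists (fun k => nth m0 (map g l) k); rewrite sat_rename.
  apply: (iffLR (lP _ _ _)) h => -[[i|w]|x] //= wl.
  by rewrite nth_posI.
rewrite sat_rename => h; exists (fun w => z (posI l (inl (inr w)))).
rewrite psiP; move: h; congr sat.
by apply/funext => -[[i|w]|x].
Qed.

End Definable.

Ltac coords := let i := fresh in move=> i; by [left; eexists | right; eexists | case: i => i; left; eexists].

(** * Definable relations and equality of types *)

Section Relations.
Context (L : language) (M : structure L).
Implicit Types C D : set M.

Definition dfn2 C X Y (R : (X -> M) -> (Y -> M) -> Prop) : Prop :=
  dfn C (fun c : X + Y -> M => R (c \o inl) (c \o inr)).

Lemma dfn2_sub C X Y J (R : (X -> M) -> (Y -> M) -> Prop)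
    (f : (J -> M) -> X -> M) (g : (J -> M) -> Y -> M) :
  coordinatewise C f -> coordinatewise C g -> dfn2 C R -> dfn C (fun c => R (f c) (g c)).
Proof.
move=> hf hg; apply: (dfn_sub (h := fun c => join (f c) (g c))) => -[x|y].
  by have [[j h]|[m Cm h]] := hf x; [left; exists j|right; exists m].
by have [[j h]|[m Cm h]] := hg y; [left; exists j|right; exists m].
Qed.

Lemma dfn_comp C I J (f : I -> J) (S : set (I -> M)) : dfn C S -> dfn C (fun c => S (c \o f)).
Proof. by apply: (dfn_sub (h := fun c => c \o f)); coords. Qed.

Lemma dfn2_ex C I V (R : (I -> M) -> (V -> M) -> Prop) :
  dfn2 C R -> dfn C (fun c => exists v, R c v).
Proof. exact: (@dfn_ex L M C I V). Qed.

Lemma dfn2_all C I V (R : (I -> M) -> (V -> M) -> Prop) :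
  dfn2 C R -> dfn C (fun c => forall v, R c v).
Proof.
move=> /dfn_not h; have := dfn_not (dfn2_ex (R := fun c v => ~ R c v) h).
by apply: dfn_ext => c; split=> [h' v|h' [v]//]; apply: contrapT => n; apply: h'; exists v.
Qed.

(** The parameters taken from [a] become variables. An element may lie both in [C] and in the range
    of [a], so [f] chooses how each parameter is named. *)
Lemma dfn_abs C I X (a : X -> M) (S : set (I -> M)) : dfn (C `|` range a) S ->
  exists2 R : (I -> M) -> (X -> M) -> Prop, dfn2 C R & forall c, S c <-> R c a.
Proof.
move=> [psi psiP].
have /choice[f fP] : forall z : (C `|` range a : set M), exists w : X + C,
    val z = join a val w.
  move=> z; case: (set_valP z) => [Cz|[x _ xz]]; last by exists (inl x).
  by exists (inr (SigSub (mem_set Cz))).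
pose g z : (I + X) + C := match z with
  | inl i => inl (inl i)
  | inr z => match f z with inl x => inl (inr x) | inr m => inr m end end.
exists (fun c x => sat (join (join c x) val) (rename g psi)).
  exists (rename g psi) => c; set v := join _ _; set w := join _ _.
  by suff -> : v = w by []; apply/funext => -[[]|].
move=> c; rewrite psiP sat_rename; set v := join _ _; set w := _ \o _.
suff -> : v = w by []; apply/funext => -[i|z] //=.
by rewrite /v /w /g /= fP; case: (f z).
Qed.

Lemma dfn2_inst C I X (a : X -> M) (R : (I -> M) -> (X -> M) -> Prop) :
  dfn2 C R -> dfn (C `|` range a) (fun c => R c a).
Proof.
move=> h; apply: (dfn2_sub (f := id) (g := fun _ => a)); [by coords| |].
  by move=> x; right; exists (a x) => //; right; exists x.
by apply: dfn_mono h; apply: subsetUl.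
Qed.

(** Equality of types over [C]; one implication is enough because definable sets are closed under
    complement. *)
Definition eqv C I (c c' : I -> M) : Prop := forall S, dfn C S -> S c -> S c'.

Lemma eqv_sym C I (c c' : I -> M) : eqv C c c' -> eqv C c' c.
Proof. by move=> h S dS Sc'; apply: contrapT => n; apply: (h _ (dfn_not dS) n). Qed.

Lemma eqv_trans C I (c c' c'' : I -> M) : eqv C c c' -> eqv C c' c'' -> eqv C c c''.
Proof. by move=> h h' S dS /(h _ dS); apply: h'. Qed.

Lemma eqv_mono C D I (c c' : I -> M) : C `<=` D -> eqv D c c' -> eqv C c c'.
Proof. by move=> CD h S /(dfn_mono CD); apply: h. Qed.

Lemma eqv_sub C I J (c c' : J -> M) (h : (J -> M) -> I -> M) :
  coordinatewise C h -> eqv C c c' -> eqv C (h c) (h c').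
Proof. by move=> hh e S dS; apply: (e (fun c => S (h c))); apply: dfn_sub. Qed.

Lemma eqv_comp C I J (c c' : J -> M) (f : I -> J) : eqv C c c' -> eqv C (c \o f) (c' \o f).
Proof. by apply: (eqv_sub (h := fun c => c \o f)); coords. Qed.

Lemma holds_inst I J (phi : formula L (I + J)) (c : I -> M) (d : J -> M) :
  holds c (inst phi d) <-> sat (join c d) phi.
Proof.
rewrite /holds /inst sat_rename; set v := _ \o _; set w := join _ _.
by suff -> : v = w by []; apply/funext => -[].
Qed.

Lemma over_dfn C I (theta : formula L (I + M)) : Defs.over C theta -> dfn C (fun c => holds c theta).
Proof. by move=> [psi ->]; exists psi => c; rewrite holds_inst. Qed.

Lemma dfn_over C I (S : set (I -> M)) : dfn C S ->
  exists2 theta, Defs.over C theta & forall c, holds c theta <-> S c.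
Proof.
move=> [psi psiP]; exists (inst psi val); first by exists psi.
by move=> c; rewrite holds_inst psiP.
Qed.

Lemma rename_term_comp V W X (g : V -> W) (h : W -> X) (t : term L V) :
  rename_term h (rename_term g t) = rename_term (h \o g) t.
Proof. by elim: t => //= s ts IH; congr App; apply/funext => i; apply: IH. Qed.

Lemma rename_comp V W X (g : V -> W) (h : W -> X) (phi : formula L V) :
  rename h (rename g phi) = rename (h \o g) phi.
Proof.
elim: phi W X g h => //= {V}.
- by move=> V s t W X g h; rewrite !rename_term_comp.
- by move=> V r ts W X g h; congr Rel; apply/funext => i; apply: rename_term_comp.
- by move=> V p IHp q IHq W X g h; rewrite IHp IHq.
- by move=> V p IH W X g h; rewrite IH; congr (All (rename _ _)); apply/funext => -[].
Qed.

Lemma over_inst C I J (phi : formula L (I + J)) (d : J -> M) : range d `<=` C ->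
  Defs.over C (inst phi d).
Proof.
move=> dC; pose f (j : J) : C := SigSub (mem_set (dC _ (imageT d j))).
exists (rename (fun z => match z with inl i => inl i | inr j => inr (f j) end) phi).
by rewrite /inst rename_comp; congr (rename _ _); apply/funext => -[].
Qed.

Lemma over_and C I (theta eta : formula L (I + M)) :
  Defs.over C theta -> Defs.over C eta -> Defs.over C (And theta eta).
Proof. by move=> [psi ->] [psi' ->]; exists (And psi psi'). Qed.

Lemma over_not C I (theta : formula L (I + M)) : Defs.over C theta -> Defs.over C (Not theta).
Proof. by move=> [psi ->]; exists (Not psi). Qed.

Lemma over_mono C D I (theta : formula L (I + M)) : C `<=` D -> Defs.over C theta -> Defs.over D theta.
Proof. by move=> CD [psi ->]; apply: over_inst => _ [x _ <-]; apply: CD; apply: set_valP. Qed.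

Lemma tp_eqv C I (c c' : I -> M) : tp c C = tp c' C <-> eqv C c c'.
Proof.
split=> [h S dS Sc|h].
  have [theta oth thP] := dfn_over dS.
  have : tp c C theta by split=> //; apply/thP.
  by rewrite h => -[_ /thP].
apply/seteqP; split=> theta [oth hth]; split=> //.
  exact: h (over_dfn oth) hth.
exact: (eqv_sym h) (over_dfn oth) hth.
Qed.

Lemma implies_tp C I (c : I -> M) (S : set (I -> M)) : Defs.implies (tp c C) S ->
  exists R, [/\ dfn C R, R c & R `<=` S].
Proof.
move=> [n [theta [th thS]]]; exists (fun c => forall i, holds c (theta i)); split=> //.
  by apply: dfn_forall_fin => i; apply: over_dfn; have [] := th i.
by move=> i; have [] := th i.
Qed.

Lemma tp_implies C I (c : I -> M) (R S : set (I -> M)) :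
  dfn C R -> R c -> R `<=` S -> Defs.implies (tp c C) S.
Proof.
move=> /dfn_over [theta oth thP] Rc RS; exists 1, (fun=> theta); split=> [_|c' /(_ ord0)/thP/RS//].
by split=> //; apply/thP.
Qed.

(** * Automorphisms *)

Definition aut C (s : M -> M) : Prop := automorphism s /\ forall x, C x -> s x = x.

Lemma eval_aut (s : M -> M) V (v : V -> M) (t : term L V) : automorphism s ->
  eval (s \o v) t = s (eval v t).
Proof.
move=> [_ sf _]; elim: t => //= g ts IH; rewrite sf; congr fun_interp.
by apply/funext => i; apply: IH.
Qed.

Lemma sat_aut (s : M -> M) V (v : V -> M) (phi : formula L V) : automorphism s ->
  sat (s \o v) phi <-> sat v phi.
Proof.
move=> sA; have [[s' sK s'K] _ sr] := sA; elim: phi v => //= {V}.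
- move=> V t u v; rewrite !eval_aut //; split=> [e|e]; last by rewrite e.
  exact: (can_inj sK).
- move=> V r ts v; rewrite (_ : (fun i => eval (s \o v) (ts i)) = s \o (fun i => eval v (ts i))).
    exact: iff_sym (sr _ _).
  by apply/funext => i; apply: eval_aut.
- by move=> V p IHp q IHq v; rewrite IHp IHq.
- move=> V p IH v; split=> h x.
    by apply/IH; move: (h (s x)); congr sat; apply/funext => -[].
  have /IH := h (s' x); congr sat.
  by apply/funext => -[//|] /=; apply: s'K.
Qed.

Lemma aut_inv C (s : M -> M) : aut C s -> exists s', [/\ aut C s', cancel s s' & cancel s' s].
Proof.
move=> [sA sC]; have [[s' sK s'K] sf sr] := sA; exists s'; split=> //; split; last first.
  by move=> x Cx; rewrite -[x in LHS]sC.
split; first by exists s.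
- move=> f a; apply: (can_inj sK); rewrite s'K sf; congr fun_interp.
  by apply/funext => i /=; rewrite s'K.
- move=> r a; have := sr r (s' \o a); rewrite (_ : s \o (s' \o a) = a); first exact: iff_sym.
  by apply/funext => i /=; rewrite s'K.
Qed.

Lemma dfn_aut C (s : M -> M) I (S : set (I -> M)) c : aut C s -> dfn C S -> S (s \o c) <-> S c.
Proof.
move=> [sA sC] [psi psiP]; rewrite !psiP -(sat_aut (join c val) psi sA).
suff -> : join (s \o c) val = s \o join c (val : C -> M) by [].
by apply/funext => -[i|z] //=; rewrite sC //; apply: set_valP.
Qed.

Lemma aut_eqv C (s : M -> M) I (c : I -> M) : aut C s -> eqv C c (s \o c).
Proof. by move=> sA S dS /(dfn_aut c sA dS). Qed.

End Relations.

(** * Ultrafilters *)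

Record ultra T (U : set (set T)) : Prop := Ultra {
  ultraI : forall P Q, U P -> U Q -> U (P `&` Q);
  ultraS : forall P Q, P `<=` Q -> U P -> U Q;
  ultra0 : ~ U set0;
  ultra_or : forall P, U P \/ U (~` P) }.

Section Ultra.
Context (T : Type).
Implicit Types (U B : set (set T)).

Lemma ultra_ex U P : ultra U -> U P -> exists x, P x.
Proof.
move=> uU UP; apply: contrapT => n; apply: (ultra0 uU).
by apply: (ultraS uU _ UP) => x Px; apply: n; exists x.
Qed.

Lemma ultraT U P : ultra U -> (forall x, P x) -> U P.
Proof.
by move=> uU h; have [//|/(ultra_ex uU) [x]] := ultra_or uU P; case; apply: h.
Qed.

Lemma ultraC U P : ultra U -> U (~` P) <-> ~ U P.
Proof.
move=> uU; split=> [UnP UP|nP]; last by have [] := ultra_or uU P.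
by have [x []] := ultra_ex uU (ultraI uU UP UnP).
Qed.

Lemma ultra_forall_in U X (l : seq X) (P : X -> set T) : ultra U ->
  (forall x, x \inl l -> U (P x)) -> U [set t | forall x, x \inl l -> P x t].
Proof.
move=> uU; elim: l => [|x l IH] h; first by apply: ultraT => // t y [].
have h1 := h x (or_introl erefl).
have h2 := IH (fun y yl => h y (or_intror yl)).
by apply: (ultraS uU _ (ultraI uU h1 h2)) => t [Px Pl] y [<-|/Pl].
Qed.

Lemma ultra_forall_fin U (X : finType) (P : X -> set T) : ultra U ->
  (forall x, U (P x)) -> U [set t | forall x, P x t].
Proof.
move=> uU h; apply: (ultraS uU _ (ultra_forall_in uU (fun x (_ : x \inl enum X) => h x))).
by move=> t ht x; apply: ht; apply: inl_enum.
Qed.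

Lemma fip_ultra B :
  (forall l : seq (set T), (forall P, P \inl l -> B P) -> exists x, forall P, P \inl l -> P x) ->
  exists U, ultra U /\ B `<=` U.
Proof.
move=> fip.
pose F : set_system T := fun P => exists l, (forall Q, Q \inl l -> B Q) /\
  forall x, (forall Q, Q \inl l -> Q x) -> P x.
have FF : ProperFilter F.
  apply: Build_ProperFilter_ex.
    by move=> P [l [/fip [x xl] h]]; exists x; apply: h.
  split; first by exists [::].
  - move=> P Q [l [lB lP]] [k [kB kQ]]; exists (l ++ k); split.
      by move=> R Rlk; have [Rl|Rk] := List.in_app_or l k R Rlk; [apply: lB|apply: kB].
    move=> x h; split; [apply: lP|apply: kQ] => R Rl; apply: h; apply/List.in_or_app; by [left|right].
  - by move=> P Q PQ [l [lB lP]]; exists l; split=> // x /lP /PQ.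
have [U [UU FU]] := ultraFilterLemma FF.
exists U; split; last by move=> P BP; apply: FU; exists [:: P]; split=> [Q [<-|//]|x hx]; [|apply: hx; left].
split.
- by move=> P Q; apply: filterI.
- by move=> P Q; apply: filterS.
- exact: filter_not_empty.
- by move=> P; apply: in_ultra_setVsetC.
Qed.

Lemma directed_ultra B : (exists P, B P) -> (forall P, B P -> exists x, P x) ->
  (forall P Q, B P -> B Q -> exists2 R, B R & R `<=` P `&` Q) ->
  exists U, ultra U /\ B `<=` U.
Proof.
move=> [P0 B0] ne dir; apply: fip_ultra => l lB.
have [R BR RP] : exists2 R, B R & forall x, R x -> forall P, P \inl l -> P x.
  elim: l lB => [|P l IH] lB; first by exists P0.
  have [R BR Rl] := IH (fun Q Ql => lB Q (or_intror Ql)).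
  have [R' BR' R'P] := dir _ _ BR (lB P (or_introl erefl)).
  by exists R' => // x /R'P [/Rl h Px] Q [<-|/h].
by have [x Rx] := ne _ BR; exists x; apply: RP.
Qed.

End Ultra.

Lemma ultra_pushforward T T' (U : set (set T)) (f : T -> T') : ultra U ->
  ultra (fun P => U (f @^-1` P)).
Proof.
move=> uU; split=> [P Q|P Q PQ||P]; [exact: ultraI| |exact: ultra0|exact: ultra_or].
by apply: ultraS => // x; apply: PQ.
Qed.

(** * Homogeneity and saturation of the monster model for small tuples *)

Lemma emb_nat_formula (L : language) : emb nat (formula L nat).
Proof. by exists (fun n => Eq (Var L n) (Var L n)) => x y []. Qed.

Section Monster.
Context (L : language) (T : set (sentence L)) (K : Type) (M : structure L).
Hypothesis M_monster : monster_model M K T.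
Implicit Types C D : set M.

Local Notation sm := (sm K).

Let F_inf := emb_nat_formula L.
Let F_small : small K [set: formula L nat].
Proof. by case: M_monster. Qed.

Lemma small_sum X Y : sm X -> sm Y -> sm (X + Y).
Proof. exact: (sm_sum F_inf F_small). Qed.

Lemma small_prod X Y : sm X -> sm Y -> sm (X * Y).
Proof. exact: (sm_prod F_inf F_small). Qed.

Lemma small_nat : sm nat.
Proof. exact: (sm_nat F_inf F_small). Qed.

Lemma small_union X (A B : set X) : sm A -> sm B -> sm (A `|` B : set X).
Proof. exact: (sm_union F_inf F_small). Qed.

Lemma small_fin (X : finType) : sm X.
Proof.
by apply: sm_emb small_nat; exists (fun x => enum_rank x : nat) => x y /val_inj /enum_rank_inj.
Qed.

(** The map sending [c i] to [c' i] and fixing [C] is well defined, since equality of two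
    coordinates, or of a coordinate and a parameter, is part of the type. It is elementary, so
    strong homogeneity extends it. *)
Lemma eqv_aut C I (c c' : I -> M) : sm C -> sm I -> eqv C c c' ->
  exists2 s, aut C s & s \o c = c'.
Proof.
move=> sC sI e; pose X := C `|` range c.
have /choice[g gP] : forall z : X, exists w : I + C, val z = join c val w.
  move=> z; case: (set_valP z) => [Cz|[i _ iz]]; last by exists (inl i).
  by exists (inr (SigSub (mem_set Cz))).
pose f x := match pselect (X x) with
  | left Xx => join c' val (g (SigSub (mem_set Xx))) | right _ => x end.
have fE (w : I + C) (z : X) : val z = join c val w -> f (val z) = join c' val w.
  move=> zw; rewrite /f; case: pselect => [Xz|]; last by case; apply: set_valP.
  set z' := SigSub _; have z'E : val z' = join c val w by rewrite /= zw.
  have : dfn C (fun c : I -> M => join c val (g z') = join c val w).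
    by exists (Eq (Var L (g z')) (Var L w)).
  by move=> /e; apply; rewrite -gP.
have [_ _ _ hom] := M_monster.
have [] := hom X f.
- by apply/smE; apply: small_union => //; apply: sm_range.
- move=> phi; rewrite (_ : val = join c val \o g); last by apply/funext.
  rewrite (_ : f \o _ = join c' val \o g); last first.
    by apply/funext => z /=; rewrite -gP; apply: fE.
  rewrite -!sat_rename; split; first by apply: (e (fun c => sat (join c val) _)); exists (rename g phi).
  by apply: (eqv_sym e (S := fun c => sat (join c val) _)); exists (rename g phi).
- move=> s sA sf; exists s; first split=> // x Cx.
    rewrite sf; last by left.
    have Xx : X x by left.
    exact: (fE (inr (SigSub (mem_set Cx))) (SigSub (mem_set Xx))).
  apply/funext => i /=; have Xi : X (c i) by right; exists i.
  by rewrite sf // (fE (inl i) (SigSub (mem_set Xi))).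
Qed.

Lemma saturated1 C (U : set (set M)) : sm C -> ultra U ->
  exists x, forall S : set (unit -> M), dfn C S -> U [set y | S (fun=> y)] -> S (fun=> x).
Proof.
move=> sC uU; have [_ _ sat1 _] := M_monster.
pose p : set (formula L (unit + M)) :=
  [set theta | Defs.over C theta /\ U [set y | holds (fun=> y) theta]].
have [||c cP] := sat1 C p; first exact/smE.
  split.
  - by move=> theta [].
  - move=> [n [theta [th th0]]].
    have [x xP] := ultra_ex uU (ultra_forall_fin uU (fun i => (th i).2)).
    exact: th0 xP.
  - move=> theta oth; have [h|h] := ultra_or uU [set y | holds (fun=> y) theta].
      by left.
    by right; split; first exact: over_not.
exists (c tt) => S dS US; have [theta oth thP] := dfn_over dS.
have /cP /thP : p theta by split=> //; apply: ultraS US => // y /thP.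
by congr S; apply/funext => -[].
Qed.

Section Saturation.
Context (I : Type) (D : set M) (U : set (set (I -> M))).
Hypotheses (sI : sm I) (sD : sm D) (uU : ultra U).

(** A partial assignment of values to coordinates, every finite part of which satisfies what [U]
    demands over [D]. Repetitions in [f] are allowed, which forces the graph to be functional. *)
Definition realizes_graph (G : set (I * M)) : Prop :=
  forall (V : finType) (f : V -> I) (g : V -> M), (forall e, G (f e, g e)) ->
  forall S : set (V -> M), dfn D S -> U [set c : I -> M | S (c \o f)] -> S g.

Let maximal_graph : exists G, realizes_graph G /\ forall B, G `<` B -> ~ realizes_graph B.
Proof.
apply: Zorn_bigcup => F FP tot V f g Gfg S dS US.
have [[A0 FA0]|F0] := pselect (F !=set0); last first.
  have V0 (e : V) : False by have [A FA _] := Gfg e; apply: F0; exists A.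
  have [c Sc] := ultra_ex uU US; move: Sc => /=; congr S.
  by apply/funext => e; case: (V0 e).
have chain (l : seq V) : exists2 A, F A & forall e, e \inl l -> A (f e, g e).
  elim: l => [|e l [A FA Al]]; first by exists A0.
  have [B FB Be] := Gfg e; have [AB|BA] := tot _ _ FA FB.
    by exists B => // e' [<-//|/Al /AB].
  by exists A => // e' [<-|/Al //]; apply: BA.
have [A FA Al] := chain (enum V).
by apply: (FP A FA V f g) => // e; apply: Al; apply: inl_enum.
Qed.

Let optf (V W : Type) (f : V -> W) (w : W) (o : option V) : W := if o is Some e then f e else w.

(** Saturation is given for one variable only, so a maximal partial assignment is shown to be total
    by realizing one further coordinate. *)
Lemma realize : exists c : I -> M, forall S, dfn D S -> U S -> S c.
Proof.
have [G [PG maxG]] := maximal_graph.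
have Gfun i m m' : G (i, m) -> G (i, m') -> m = m'.
  move=> Gm Gm'.
  apply: (PG bool (fun=> i) (fun b => if b then m else m') _ (fun z => z true = z false)).
  - by case.
  - exact: dfn_eq.
  - exact: ultraT.
have [/choice[c cP]|/existsNP[i Gi]] := pselect (forall i, exists m, G (i, m)).
  exists c => S dS US; have [l lP] := dfn_supp dS.
  pose V := 'I_(size l); pose f : V -> I := tnth (in_tuple l).
  pose S' (z : V -> M) := exists c', (forall e, c' (f e) = z e) /\ S c'.
  have dS' : dfn D S'.
    apply: (dfn2_ex (R := fun z c' => (forall e, c' (f e) = z e) /\ S c')).
    apply: dfn_and; last exact: (dfn_comp inr dS).
    by apply: dfn_forall_fin => e; apply: dfn_eq.
  have [] := PG V f (c \o f) (fun e => cP (f e)) S' dS'.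
    by apply: ultraS US => // c' Sc'; exists c'.
  move=> c' [c'f]; apply: (iffLR (lP _ _ _)) => w wl.
  have -> : w = f (Ordinal (pos_size wl)) by rewrite /f (tnth_nth w) /= nth_pos.
  exact: c'f.
exfalso.
pose ran := [set m | exists i, G (i, m)].
have sran : sm ran.
  have /choice[h hP] : forall m : ran, exists i, G (i, val m) by move=> m; have [k Gk] := set_valP m; exists k.
  apply: sm_emb sI; exists h => m m' e; apply: val_inj.
  by apply: (Gfun (h m)) (hP m) _; rewrite e.
pose B : set (set M) := [set P | exists (V : finType) (f : V -> I) (g : V -> M) (S : set (option V -> M)),
  [/\ forall e, G (f e, g e), dfn D S, U [set c : I -> M | S (c \o optf f i)] &
      P = [set x | S (optf g x)]]].
have [||| W [uW BW]] := @directed_ultra M B.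
- exists [set x | True]; exists void, (of_void I), (of_void M), (fun _ => True).
  by split=> //; [exact: dfn_cst|exact: ultraT].
- move=> P [V [f [g [S [Gfg dS US ->]]]]].
  pose S' (z : V -> M) := exists x : unit -> M, S (optf z (x tt)).
  have [||x Sx] := PG V f g Gfg S'.
  + apply: (dfn2_ex (R := fun z x => S (optf z (x tt)))).
    apply: (dfn_sub (h := fun u => optf (u \o inl) (u (inr tt))) _ dS).
    by move=> [e|]; left; eexists.
  + apply: ultraS US => // c Sc; exists (fun=> c i); move: Sc => /=; congr S.
    by apply/funext => -[].
  + by exists (x tt).
- move=> P P' [V [f [g [S [Gfg dS US ->]]]]] [V' [f' [g' [S' [Gfg' dS' US' ->]]]]].
  pose f2 z := match z with inl e => f e | inr e => f' e end.
  pose g2 z := match z with inl e => g e | inr e => g' e end.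
  pose S2 (z : option (V + V') -> M) := S (z \o omap inl) /\ S' (z \o omap inr).
  exists [set x | S2 (optf g2 x)].
    exists (V + V')%type, f2, g2, S2; split=> //.
    + by case.
    + by apply: dfn_and; [exact: (dfn_comp (omap inl) dS)|exact: (dfn_comp (omap inr) dS')].
    + apply: ultraS (ultraI uU US US') => // c [] /=; rewrite /S2.
      by split; [move: a|move: b]; [congr S|congr S']; apply/funext => -[].
  by move=> x [h h']; split; [move: h; congr S|move: h'; congr S']; apply/funext => -[].
have [x xP] := saturated1 (small_union sD sran) uW.
pose G' := G `|` [set (i, x)].
apply: (maxG G').
  split; first by move=> ?; left.
  by move=> /(_ (i, x) (or_intror erefl)) Gix; apply: Gi; exists x.
move=> V f g G'fg S dS US.
pose V' := {e : V | `[< G (f e, g e) >]}.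
pose S' (z : option V' -> M) := S (fun e => z (insub e)).
have dS' : dfn D S' by exact: (dfn_comp (fun e => insub e) dS).
pose S'' (y : unit -> M) := S' (optf (fun e : V' => g (val e)) (y tt)).
have fgE (e : V) : ~~ `[< G (f e, g e) >] -> f e = i /\ g e = x.
  by move=> /asboolPn; case: (G'fg e) => // -[-> ->].
have : S'' (fun=> x).
  apply: xP.
    apply: (dfn_sub (h := fun y => optf (fun e : V' => g (val e)) (y tt))); last first.
      by apply: dfn_mono dS'; apply: subsetUl.
    move=> [e|]; last by left; exists tt.
    right; exists (g (val e)) => //; right; exists (f (val e)).
    by apply/asboolP; exact: (valP e).
  apply: BW; exists V', (fun e => f (val e)), (fun e => g (val e)), S'; split=> //.
    by move=> e; apply/asboolP; exact: (valP e).
  apply: ultraS US => // c /=; congr S; apply/funext => e /=.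
  case: insubP => [u _ ue|/fgE [-> _]] //=; by rewrite ue.
rewrite /S'' /S'; congr S; apply/funext => e.
case: insubP => [u _ ue|/fgE [_ ->]] //=; by rewrite ue.
Qed.

End Saturation.

Definition rlz I (U : set (set (I -> M))) D (c : I -> M) : Prop :=
  forall S, dfn D S -> U S -> S c.

Lemma rlz_ultra I (U : set (set (I -> M))) D c S : ultra U -> rlz U D c -> dfn D S -> S c -> U S.
Proof.
move=> uU r dS Sc; apply: contrapT => /(ultraC _ uU) nS.
exact: (r _ (dfn_not dS) nS).
Qed.

Lemma rlz_mono I (U : set (set (I -> M))) C D c : C `<=` D -> rlz U D c -> rlz U C c.
Proof. by move=> CD r S /(dfn_mono CD); apply: r. Qed.

Lemma rlz_eqv I (U : set (set (I -> M))) C D (c c' : I -> M) : ultra U -> C `<=` D ->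
  rlz U C c -> rlz U D c' -> eqv C c c'.
Proof. by move=> uU CD r r' S dS /(rlz_ultra uU r dS); apply: (rlz_mono CD r'). Qed.

(** * Small elementary submodels *)

(** This is the Tarski-Vaught test for [N] to be an elementary substructure. *)
Definition submodel (N : set M) : Prop :=
  forall S : set (unit -> M), dfn N S -> (exists c, S c) -> exists2 x, N x & S (fun=> x).

Lemma small_submodel (A : set M) : sm A -> exists N : set M, [/\ sm N, A `<=` N & submodel N].
Proof.
move=> sA; have [m0] := carrier_inhabited M.
pose Z : Type := (A + formula L nat)%type.
have eFZ : emb (formula L nat) Z by exists inr => x y [].
have eN : emb nat Z := emb_trans F_inf eFZ.
have sZ : sm Z by apply: (sm_sumF F_inf F_small).
have [j ji] : emb (formula L nat * seq Z) Z.
  exact: emb_trans (emb_prod eFZ (emb_seq eN)) (emb_square eN).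
have /choice[d dP] : forall z, exists p, (exists q, j q = z) -> j p = z.
  move=> z; have [[q qz]|n] := pselect (exists q, j q = z); first by exists q.
  by exists (Bot, [::]).
have dj q : d (j q) = q by apply: ji; apply: dP; exists q.
pose env x (l : seq M) n := nth m0 (x :: l) n.
have /choice[wit witP] : forall p : formula L nat * seq M, exists x,
    (exists y, sat (env y p.2) p.1) -> sat (env x p.2) p.1.
  move=> p; have [[y yP]|n] := pselect (exists y, sat (env y p.2) p.1); first by exists y.
  by exists m0.
(* Stage [n] of a Skolem hull is indexed by the fixed small type [Z]: a code [z] is decoded into a
   formula and a list of codes of parameters, and a witness for the formula is returned. *)
pose h := fix h n : Z -> M := match n with
  | 0 => fun z => if z is inl a then val a else m0
  | n'.+1 => fun z => wit ((d z).1, map (h n') (d z).2) end.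
(* The formula equating variables 0 and 1 has the parameter as its only witness, so each stage
   contains the previous one. *)
have hS n z : exists z', h n.+1 z' = h n z.
  exists (j (Eq (Var L 0) (Var L 1), [:: z])); rewrite [LHS]/= dj.
  by apply: (witP (Eq (Var L 0) (Var L 1), [:: h n z])); exists (h n z).
have h_mono n m z : (n <= m)%N -> exists z', h m z' = h n z.
  elim: m => [|m IH]; first by rewrite leqn0 => /eqP->; exists z.
  rewrite leq_eqVlt => /orP[/eqP<-|]; first by exists z.
  by rewrite ltnS => /IH [z' <-]; have [z'' <-] := hS m z'; exists z''.
pose N := range (fun p : nat * Z => h p.1 p.2).
exists N; split.
- by apply: sm_range; apply: small_prod => //; apply: small_nat.
- by move=> a Aa; exists (0, inl (SigSub (mem_set Aa))).
move=> S [psi psiP] [c Sc]; have [l lP] := sat_supp M psi.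
pose n0 := h 0 (inr Bot).
pose lc := map (fun w : unit + N => match w with inl _ => n0 | inr n => val n end) l.
have [k [zl zlE]] : exists k zl, map (h k) zl = lc.
  rewrite /lc; elim: l {lP lc} => [|w l [k [zl zlE]]] /=; first by exists 0, [::].
  have [k' [z zE]] : exists k' z, h k' z = match w with inl _ => n0 | inr n => val n end.
    case: w => [_|n]; first by exists 0, (inr Bot).
    by have [[k' z] _ zE] := set_valP n; exists k', z.
  have [z1 z1E] := h_mono k' (maxn k' k) z (leq_maxl _ _).
  have /choice[u uE] := fun z => h_mono k (maxn k' k) z (leq_maxr _ _).
  exists (maxn k' k), (z1 :: map u zl); rewrite /= z1E zE; congr (_ :: _).
  by rewrite -zlE -map_comp; apply: eq_map => z' /=; apply: uE.
pose e (w : unit + N) := match w with inl _ => 0 | inr _ => (pos l w).+1 end.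
have key x : sat (env x lc) (rename e psi) <-> S (fun=> x).
  rewrite sat_rename psiP; apply: lP => -[[]|n] //= wl.
  by rewrite /env /lc /= (nth_map (inr n)) ?pos_size // nth_pos.
exists (h k.+1 (j (rename e psi, zl))); first by exists (k.+1, j (rename e psi, zl)).
apply/key; rewrite /= dj /= zlE; apply: (witP (rename e psi, lc)) => /=.
exists (c tt); apply/key; move: Sc; congr S; by apply/funext => -[].
Qed.

Lemma submodelP N I (S : set (I -> M)) : submodel N -> dfn N S -> (exists c, S c) ->
  exists2 c, (forall i, N (c i)) & S c.
Proof.
move=> mN dS [c Sc]; have [l lP] := dfn_supp dS; have [m0] := carrier_inhabited M.
have [n0 Nn0 _] := mN (fun _ => True) (dfn_cst _ _ _) (ex_intro _ (fun=> m0) Logic.I).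
have [c' Sc' Nc'] : exists2 c', S c' & forall i, i \inl l -> N (c' i).
  elim: l {lP} => [|i l [c' Sc' Nc']]; first by exists c.
  pose S' (x : unit -> M) := exists u : I -> M,
    [/\ S u, u i = x tt & forall k, k \inl l -> u k = c' k].
  have [||x Nx [u [Su uix ul]]] := mN S'.
  - apply: (dfn2_ex (R := fun x u => [/\ S u, u i = x tt & forall k, k \inl l -> u k = c' k])).
    have h1 : dfn N (fun v : unit + I -> M => S (v \o inr)) := dfn_comp inr dS.
    have h2 : dfn N (fun v : unit + I -> M => v (inr i) = v (inl tt)) := dfn_eq _ _ _.
    have h3 : dfn N (fun v : unit + I -> M => forall k, k \inl l -> v (inr k) = c' k).
      by apply: dfn_forall_in => k kl; apply: dfn_eq_cst; apply: Nc'.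
    apply: dfn_ext (dfn_and h1 (dfn_and h2 h3)) => v.
    by split=> [[? []]|[]].
  - by exists (fun=> c' i), c'.
  by exists u => // k [<-|kl]; [rewrite uix | rewrite ul //; apply: Nc'].
pose c'' i := if `[< i \inl l >] then c' i else n0.
exists c''; first by move=> i; rewrite /c''; case: asboolP => // /Nc'.
apply: (iffLR (lP _ _ _)) Sc' => i il; rewrite /c''.
by case: asboolP.
Qed.

End Monster.

(** * Dividing and the tree property *)

Definition kinc X (k : nat) (P : nat -> set X) : Prop :=
  forall s : 'I_k -> nat, injective s -> ~ exists x, forall i, P (s i) x.

Section Dividing.
Context (L : language) (M : structure L).
Implicit Types C D N : set M.

(* chi(x, a) divides over [C]. *)
Definition divR C X Y (chi : (X -> M) -> (Y -> M) -> Prop) (a : Y -> M) : Prop :=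
  exists k (ds : nat -> Y -> M), (forall j, eqv C a (ds j)) /\ kinc k (fun j x => chi x (ds j)).

Lemma divR_eqv C X Y (chi : (X -> M) -> (Y -> M) -> Prop) (a a' : Y -> M) :
  eqv C a a' -> divR C chi a -> divR C chi a'.
Proof.
move=> e [k [ds [dsP inc]]]; exists k, ds; split=> // j.
exact: eqv_trans (eqv_sym e) (dsP j).
Qed.

Lemma divR_comp C X X' Y (f : X' -> X) (chi : (X' -> M) -> (Y -> M) -> Prop) (a : Y -> M) :
  divR C chi a -> divR C (fun x y => chi (x \o f) y) a.
Proof.
move=> [k [ds [dsP inc]]]; exists k, ds; split=> // s si [x xP].
by apply: (inc s si); exists (x \o f).
Qed.

(** The tuples of variables and parameters may be infinite here; the support of the formula cuts
    them down to finite ones, the constants of [C] joining the parameters. Finite paths suffice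
    because consistency concerns finite parts. *)
Lemma TP2_intro C X Y (chi : (X -> M) -> (Y -> M) -> Prop) k (a : nat -> nat -> Y -> M) :
  dfn2 C chi -> (forall i, kinc k (fun j x => chi x (a i j))) ->
  (forall (eta : nat -> nat) n, exists x, forall i, (i < n)%N -> chi x (a i (eta i))) -> TP2 M.
Proof.
move=> [psi psiP] rows paths; have [l lP] := sat_supp M psi; have [m0] := carrier_inhabited M.
pose f (z : (X + Y) + C) : 'I_(size l).+1 + 'I_(size l).+1 :=
  if z is inl (inl _) then inl (posI l z) else inr (posI l z).
pose b i j (e : 'I_(size l).+1) := nth m0 (map (join (join (fun=> m0) (a i j)) val) l) e.
have bP x' i j : sat (join x' (b i j)) (rename f psi) <->
    chi (fun x => x' (posI l (inl (inl x)))) (a i j).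
  have := psiP (join (fun x => x' (posI l (inl (inl x)))) (a i j)).
  rewrite sat_rename => ->; apply: lP => -[[x|y]|z] //= wl;
  by rewrite /b nth_posI.
pose up (x : X -> M) (e : 'I_(size l).+1) := nth m0 (map (join (join x (fun=> m0)) (val : C -> M)) l) e.
have upP x i j : sat (join (up x) (b i j)) (rename f psi) <-> chi x (a i j).
  have := psiP (join x (a i j)).
  rewrite sat_rename => ->; apply: lP => -[[y|y]|z] //= wl;
  by rewrite /b /up nth_posI.
exists (size l).+1, (size l).+1, (rename f psi), k, b; split.
  move=> i s si [x' x'P]; apply: (rows i s si).
  exists (fun x => x' (posI l (inl (inl x)))) => e; apply/bP.
  exact: (iffLR (holds_inst _ _ _) (x'P e)).
move=> eta [n [theta [th none]]].
have /choice[e eP] : forall i, exists j, inst (rename f psi) (b j (eta j)) = theta i.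
  by move=> i; have [j _ jE] := th i; exists j.
have [x xP] := paths eta (\max_i e i).+1.
apply: (none (up x)) => i; rewrite -eP; apply/holds_inst; apply/upP; apply: xP.
by rewrite ltnS (leq_bigmax i).
Qed.

(** * Coheirs and their Morley sequences *)

(* An ultrafilter of tuples of [M] plays the role of a global type; [coh] says that it
   is finitely satisfiable in [N]. *)
Definition coh N I (U : set (set (I -> M))) : Prop :=
  forall P, U P -> exists2 c, (forall i, N (c i)) & P c.

(** A coheir is invariant: a tuple of [N] satisfying [R _ e] but not [R _ e'] would contradict the
    equality of the types of [e] and [e'] over [N]. *)
Lemma coh_inv N I E (U : set (set (I -> M))) (R : (I -> M) -> (E -> M) -> Prop) e e' :
  ultra U -> coh N U -> dfn2 N R -> eqv N e e' -> U [set c | R c e] -> U [set c | R c e'].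
Proof.
move=> uU cU dR ee Ue; have [//|nUe'] := ultra_or uU [set c | R c e'].
have [c Nc [Rce]] := cU _ (ultraI uU Ue nUe'); case.
apply: (ee (fun e => R c e)) => //; apply: dfn2_sub dR; last by coords.
by move=> i; right; exists (c i).
Qed.

(* The tuple (g 0, ..., g r), padded with g r so that its index type does not depend
   on r. *)
Definition stut Y (r : nat) (g : nat -> Y -> M) (z : nat * Y) : M := g (minn z.1 r) z.2.

(* No condition on [g 0]: the sequence is determined up to its type by that of [g 0]. *)
Definition mor N Y (V : nat -> set (set (Y -> M))) (g : nat -> Y -> M) : Prop :=
  forall r, rlz (V r.+1) (N `|` [set m | exists i y, (i <= r)%N /\ g i y = m]) (g r.+1).

(** By invariance of coheirs, the type of each term over the previous ones depends only on the type
    of these, so equality of types passes from [stut r] to [stut r.+1]. *)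
Lemma mor_eqv N Y V (g h : nat -> Y -> M) : (forall i, ultra (V i)) -> (forall i, coh N (V i)) ->
  mor N V g -> mor N V h -> eqv N (g 0) (h 0) -> forall r, eqv N (stut r g) (stut r h).
Proof.
move=> uV cV mg mh e0; elim=> [|r IH].
  have s0 u : stut 0 u = u 0 \o snd :> (nat * Y -> M).
    by apply/funext => -[i y]; rewrite /stut /= minn0.
  by rewrite !s0; apply: eqv_comp.
move=> S dS.
pose comb (u : nat * Y -> M) (c : Y -> M) (z : nat * Y) := if (z.1 <= r)%N then u z else c z.2.
have combE u : stut r.+1 u = comb (stut r u) (u r.+1).
  apply/funext => -[i y]; rewrite /comb /stut /=; case: leqP => ir.
    by rewrite (minn_idPl (leqW ir)).
  by rewrite (minn_idPr ir).
pose R c u := S (comb u c).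
have dR : dfn2 N R.
  apply: (dfn_sub (h := fun v : Y + nat * Y -> M => comb (v \o inr) (v \o inl)) _ dS).
  by move=> z; left; rewrite /comb; case: leqP => _; eexists.
have dRi u : dfn (N `|` [set m | exists i y, (i <= r)%N /\ u i y = m]) (fun c => R c (stut r u)).
  apply: dfn_mono (dfn2_inst (stut r u) dR) => x [Nx|[[i y] _ <-]]; [by left|right].
  by exists (minn i r), y; rewrite geq_minr.
rewrite !combE => Sg; apply: (mh r _ (dRi h)).
by apply: (coh_inv (uV _) (cV _) dR IH); apply: rlz_ultra (mg r) (dRi g) Sg.
Qed.

Definition good N Y (a : Y -> M) (V : nat -> set (set (Y -> M))) : Prop :=
  forall i, [/\ ultra (V i), coh N (V i) & forall S, dfn N S -> S a -> V i S].

Definition minc N X Y (a : Y -> M) V k (chi : (X -> M) -> (Y -> M) -> Prop) : Prop :=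
  forall h, mor N V h -> eqv N a (h 0) -> ~ exists x, forall i, (i < k)%N -> chi x (h i).

(** Consistency of the first [k] instances is part of the type of the sequence over [N], which [V]
    and the type of the first term determine. *)
Lemma mor_transfer N X Y (a : Y -> M) V k (chi : (X -> M) -> (Y -> M) -> Prop) g h :
  dfn2 N chi -> good N a V -> mor N V g -> eqv N a (g 0) -> mor N V h -> eqv N a (h 0) ->
  (exists x, forall i, (i < k)%N -> chi x (h i)) -> exists x, forall i, (i < k)%N -> chi x (g i).
Proof.
move=> dchi gV mg eg mh eh.
pose S (u : nat * Y -> M) := exists x, forall i : 'I_k, chi x (fun y => u (val i, y)).
have dS : dfn N S.
  apply: (dfn2_ex (R := fun u x => forall i : 'I_k, chi x (fun y => u (val i, y)))).
  apply: dfn_forall_fin => i.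
  by apply: (dfn2_sub (f := fun v => v \o inr) (g := fun v y => v (inl (val i, y))) _ _ dchi); coords.
have SE u : S (stut k u) <-> exists x, forall i, (i < k)%N -> chi x (u i).
  have sE (i : nat) : (i < k)%N -> (fun y => stut k u (i, y)) = u i.
    by move=> ik; apply/funext => y; rewrite /stut /= (minn_idPl (ltnW ik)).
  split=> -[x xP]; exists x => i.
    by move=> ik; have := xP (Ordinal ik); rewrite /= sE.
  by rewrite sE ?ltn_ord //; apply: xP; apply: ltn_ord.
move=> /SE Sh; apply/SE; apply: mor_eqv Sh => //; try by move=> i; have [] := gV i.
exact: eqv_trans (eqv_sym eh) eg.
Qed.

End Dividing.

(** * Dividing over a small model and the broom lemma *)

Section DividingMonster.
Context (L : language) (T : set (sentence L)) (K : Type) (M : structure L).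
Hypothesis M_monster : monster_model M K T.
Implicit Types C D N : set M.

Local Notation sm := (sm K).

(** Automorphisms over [C] taking [d] to the given witnesses take [a] to witnesses for [chi],
    because they preserve the implication. *)
Lemma divR_mono C X X' Y Y' (f : X' -> X) (phi : (X' -> M) -> (Y' -> M) -> Prop)
    (chi : (X -> M) -> (Y -> M) -> Prop) d a : sm C -> sm Y' -> dfn2 C phi -> dfn2 C chi ->
  (forall x, chi x a -> phi (x \o f) d) -> divR C phi d -> divR C chi a.
Proof.
move=> sC sY dphi dchi cp [k [ds [dsP inc]]].
have /choice[s sP] : forall j, exists s, aut C s /\ s \o d = ds j.
  by move=> j; have [s sA <-] := eqv_aut M_monster sC sY (dsP j); exists s.
exists k, (fun j => s j \o a); split=> [j|t ti [x xP]]; first by apply: aut_eqv; case: (sP j).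
apply: (inc t ti); exists (x \o f) => i.
have [sA <-] := sP (t i); have [s' [s'A sK s'K]] := aut_inv sA.
have xE : x = s (t i) \o (s' \o x) by apply/funext => z /=; rewrite s'K.
have aut2 V W (R : (V -> M) -> (W -> M) -> Prop) (v : V -> M) (w : W -> M) :
    dfn2 C R -> R (s (t i) \o v) (s (t i) \o w) <-> R v w.
  by move=> dR; apply: (dfn_aut (join v w) sA dR).
have := xP i; rewrite xE aut2 // => /cp.
by rewrite -(aut2 _ _ phi) //; rewrite /comp; congr phi; apply/funext => z /=; rewrite s'K.
Qed.

(** The recursion behind all Morley sequences and arrays: each new term is chosen over a small set
    containing [D0] and all earlier terms. *)
Lemma rec_rows I (D0 : set M) (Q : nat -> set M -> (I -> M) -> Prop) : sm I -> sm D0 ->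
  (forall n D, sm D -> D0 `<=` D -> exists c, Q n D c) ->
  exists (F : nat -> I -> M) (Dn : nat -> set M), forall n,
    [/\ D0 `<=` Dn n, sm (Dn n), Q n (Dn n) (F n) & forall i, (i < n)%N -> range (F i) `<=` Dn n].
Proof.
move=> sI sD0 h; have [m0] := carrier_inhabited M.
have /choice[pick pickP] : forall p : nat * set M, exists c, sm p.2 -> D0 `<=` p.2 -> Q p.1 p.2 c.
  move=> [n D]; have [[sD DD]|nD] := pselect (sm D /\ D0 `<=` D).
    by have [c cP] := h n D sD DD; exists c.
  by exists (fun=> m0) => sD DD; case: nD.
pose Dn := fix Dn n := if n is n'.+1 then Dn n' `|` range (pick (n', Dn n')) else D0.
have DnP n : D0 `<=` Dn n /\ sm (Dn n).
  elim: n => [|n [D0n sDn]]; first by split.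
  split=> [x /D0n|]; first by left.
  by apply: (small_union M_monster) => //; apply: sm_range.
exists (fun n => pick (n, Dn n)), Dn => n; have [D0n sDn] := DnP n; split=> //.
  exact: (pickP (n, Dn n)).
elim: n {D0n sDn} => // n IH i; rewrite ltnS leq_eqVlt => /orP[/eqP->|/IH h'] x.
  by right.
by move=> /h'; left.
Qed.

Section OverModel.
Context (N : set M).
Hypotheses (sN : sm N) (mN : submodel N).

Lemma coheir I (c : I -> M) : exists U, [/\ ultra U, coh N U & forall S, dfn N S -> S c -> U S].
Proof.
pose NI := [set c' : I -> M | forall i, N (c' i)].
have [||| U [uU BU]] := @directed_ultra _ [set P | exists S, [/\ dfn N S, S c & P = S `&` NI]].
- by exists (setT `&` NI), setT; split=> //; apply: (dfn_cst N I True).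
- by move=> P [S [dS Sc ->]]; have [c' Nc' Sc'] := submodelP mN dS (ex_intro _ c Sc); exists c'.
- move=> P P' [S [dS Sc ->]] [S' [dS' Sc' ->]].
  exists ((S `&` S') `&` NI); last by move=> x [[? ?] ?].
  by exists (S `&` S'); split=> //; apply: dfn_and.
have UN : U NI.
  by apply: (ultraS uU _ (BU (setT `&` NI) _)) => [x []//|]; exists setT; split=> //; apply: (dfn_cst N I True).
exists U; split=> // [P UP|S dS Sc].
  by have [c' [Pc' Nc']] := ultra_ex uU (ultraI uU UP UN); exists c'.
by apply: (ultraS uU _ (BU (S `&` NI) _)) => [x []//|]; exists S.
Qed.

Section Tuples.
Context (Y : Type) (a : Y -> M).
Hypothesis sY : sm Y.

(* The rows of the array realize a coheir of the type of a witness of dividing,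
   so every path realizes a product of coheirs of [tp(a/N)]. *)
Lemma div_coheirs X (chi : (X -> M) -> (Y -> M) -> Prop) : NTP2 M -> dfn2 N chi ->
  divR N chi a -> exists V k, good N a V /\ minc N a V k chi.
Proof.
move=> ntp2 dchi [k [ds [dsP inc]]].
have [W [uW cW dsW]] := coheir (fun z : nat * Y => ds z.1 z.2).
have sI : sm (nat * Y) by apply: (small_prod M_monster) => //; apply: (small_nat M_monster).
have [F [Dn FP]] := @rec_rows _ N (fun _ D G => rlz W D G) sI sN
  (fun n D sD _ => realize M_monster sI sD uW).
apply: contrapT => nc; apply: ntp2.
apply: (TP2_intro (k := k) (a := fun i j y => F i (j, y)) dchi) => [i s si|eta n].
  have [ND _ Fi _] := FP i.
  pose S (u : nat * Y -> M) := exists x, forall e, chi x (fun y => u (s e, y)).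
  have dS : dfn N S.
    apply: (dfn2_ex (R := fun u x => forall e, chi x (fun y => u (s e, y)))).
    apply: dfn_forall_fin => e.
    by apply: (dfn2_sub (f := fun v => v \o inr) (g := fun v y => v (inl (s e, y))) _ _ dchi); coords.
  apply: (Fi _ (dfn_mono ND (dfn_not dS))); apply: dsW; first exact: dfn_not.
  exact: inc.
(* An inconsistent path of length [n] would give the required coheirs: [V i] is the projection of
   [W] to column [eta i], and [n] serves as [k], since consistency depends only on the type over
   [N]. *)
apply: contrapT => nx; apply: nc.
pose pr i (G : nat * Y -> M) y := G (eta i, y).
pose V i : set (set (Y -> M)) := fun P => W (pr i @^-1` P).
have dpr i S : dfn N S -> dfn N (pr i @^-1` S).
  by apply: (dfn_sub (h := pr i)) => y; left; exists (eta i, y).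
have gV : good N a V.
  move=> i; split; first exact: (ultra_pushforward (pr i) uW).
    by move=> P /cW [c Nc Pc]; exists (pr i c) => // y; apply: Nc.
  move=> S dS Sa; apply: dsW; first exact: dpr.
  exact: dsP.
pose g i := pr i (F i).
have mg : mor N V g.
  move=> r S dS VS; have [ND _ Fr FD] := FP r.+1.
  apply: (Fr (pr r.+1 @^-1` S)) => //; apply: (dfn_sub (h := pr r.+1)).
    by move=> y; left; exists (eta r.+1, y).
  apply: dfn_mono dS => x [/ND//|[i [y [ir <-]]]].
  by apply: (FD i ir); exists (eta i, y).
have eg : eqv N a (g 0).
  move=> S dS Sa; have [ND _ F0 _] := FP 0.
  apply: (F0 (pr 0 @^-1` S)); first by apply: dfn_mono ND _; apply: dpr.
  by have [_ _] := gV 0; apply.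
exists V, n; split=> // h mh eh hx; apply: nx.
exact: mor_transfer dchi gV mg eg mh eh hx.
Qed.

(** Weaker than dividing, since one finite set of conjugates is enough; this is what the broom lemma
    propagates through disjunctions. *)
Definition quasi_div X (chi : (X -> M) -> (Y -> M) -> Prop) : Prop :=
  exists l : seq (Y -> M), (forall y, y \inl l -> eqv N a y) /\
    ~ exists x, forall y, y \inl l -> chi x y.

(** The broom lemma lowers [k] in this statement: the list need only be inconsistent together with
    [k] instances of [chi2] along a sequence following [V]. For [k = 0] it gives quasi-dividing of
    [chi]. *)
Let partial_broom X (chi chi2 : (X -> M) -> (Y -> M) -> Prop) k V : Prop :=
  forall h, mor N V h -> eqv N a (h 0) -> exists l : seq (Y -> M),
    (forall y, y \inl l -> eqv N a y) /\
    ~ exists x, (forall y, y \inl l -> chi x y) /\ forall i, (i < k)%N -> chi2 x (h i).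

Lemma small_list (l : seq (Y -> M)) : sm [set m : M | exists2 y, y \inl l & range y m].
Proof.
elim: l => [|y l IH].
  apply: (@sm_subset K _ _ N) sN => m [] //.
apply: (sm_subset (_ : _ `<=` range y `|` [set m | exists2 y, y \inl l & range y m])).
  by move=> m [z [<-|zl] zm]; [left|right; exists z].
by apply: (small_union M_monster) => //; apply: sm_range.
Qed.

(* The sequence [h] realizing [V 1, V 2, ...] can be taken over the parameters
   [as_] witnessing that [chi1] quasi-divides; then each [a', h 0, h 1, ...] with
   [a'] in [as_] realizes [V 0, V 1, ...], and some [a'] fails [chi1]. *)
Lemma partial_broomS X (chi1 chi2 : (X -> M) -> (Y -> M) -> Prop) k V :
  let chi x y := chi1 x y \/ chi2 x y in
  dfn2 N chi1 -> dfn2 N chi2 -> good N a V -> quasi_div chi1 ->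
  partial_broom chi chi2 k.+1 V -> partial_broom chi chi2 k (fun i => V i.+1).
Proof.
move=> chi dchi1 dchi2 gV [as_ [asP as0]] brm h mh eh.
pose D0 := N `|` [set m : M | exists2 y, y \inl as_ & range y m].
have sD0 : sm D0 by apply: (small_union M_monster) => //; apply: small_list.
have uV i : ultra (V i) by have [] := gV i.
have cV i : coh N (V i) by have [] := gV i.
have [F [Dn FP]] := @rec_rows _ D0 (fun n D c => rlz (V n) D c) sY sD0
  (fun n D sD _ => realize M_monster sY sD (uV n)).
have eF i : eqv N a (F i).
  move=> S dS Sa; have [DD _ Fi _] := FP i; apply: Fi.
    by apply: dfn_mono dS => x Nx; apply: DD; left.
  by have [_ _] := gV i; apply.
pose h' i := F i.+1.
have mh' : mor N (fun i => V i.+1) h'.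
  move=> r; have [DD _ Fr FD] := FP r.+2; apply: rlz_mono Fr => x [Nx|[i [y [ir <-]]]].
    by apply: DD; left.
  by apply: (FD i.+1); [rewrite ltnS|exists y].
(* The lists obtained for the sequences starting with the various [s] in [as_] are concatenated, so
   that one list serves all [s]. *)
have [L' [L'P L'0]] : exists L' : seq (Y -> M), (forall y, y \inl L' -> eqv N a y) /\
    forall s, s \inl as_ -> ~ exists x, [/\ forall y, y \inl L' -> chi x y, chi2 x s &
      forall i, (i < k)%N -> chi2 x (h' i)].
  have: forall s, s \inl as_ -> s \inl as_ by [].
  elim: {1 3}as_ => [|s l IH] sl; first by exists [::].
  have [L1 [L1P L10]] := IH (fun s' s'l => sl s' (or_intror s'l)).
  have sas := sl s (or_introl erefl).
  pose hs i := if i is i'.+1 then F i else s.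
  have mhs : mor N V hs.
    move=> r; have [DD _ Fr FD] := FP r.+1; apply: rlz_mono Fr => x [Nx|[[|i] [y [ir <-]]]].
    - by apply: DD; left.
    - by apply: DD; right; exists s => //; exists y.
    - by apply: (FD i.+1) => //; exists y.
  have [L2 [L2P L20]] := brm hs mhs (asP s sas).
  exists (L1 ++ L2)%list; split=> [y yl|s' [<-|s'l] [x [xL xs xh]]].
  - by case: (List.in_app_or _ _ _ yl) => [/L1P|/L2P].
    apply: L20; exists x; split=> [y yL|[|i] ik //]; last exact: xh.
    by apply: xL; apply: List.in_or_app; right.
  apply: (L10 s' s'l); exists x; split=> // y yL.
  by apply: xL; apply: List.in_or_app; left.
have gV' : good N a (fun i => V i.+1) by move=> i; apply: gV.
(* [h'] and [h] follow the same coheirs, so an automorphism over [N] carries the list found for [h']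
   to one for [h]. *)
have e := @mor_eqv _ _ N Y (fun i => V i.+1) h' h (fun i => uV i.+1) (fun i => cV i.+1) mh' mh
  (eqv_trans (eqv_sym (eF 1)) eh) k.
have sI : sm (nat * Y) by apply: (small_prod M_monster) => //; apply: (small_nat M_monster).
have [s sA sE] := eqv_aut M_monster sN sI e.
have [s' [s'A sK s'K]] := aut_inv sA.
exists (map (fun y => s \o y) (as_ ++ L')%list); split.
  move=> y /List.in_map_iff [z [<- zl]]; apply: (eqv_trans _ (aut_eqv sA)).
  by case: (List.in_app_or _ _ _ zl) => [/asP|/L'P].
move=> [x [xl xh]]; apply: as0.
have aut2 R : dfn2 N R -> forall y, R x (s \o y) -> R (s' \o x) y.
  move=> dR y; have := dfn_aut (join (s' \o x) y) sA dR => /= <-.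
  by rewrite /comp /=; congr R; apply/funext => z /=; rewrite s'K.
have dchi : dfn2 N chi := dfn_or dchi1 dchi2.
have xl' y : y \inl (as_ ++ L')%list -> chi (s' \o x) y.
  by move=> yl; apply: aut2 => //; apply: xl; apply: List.in_map.
exists (s' \o x) => y yas.
have [//|c2] := xl' y (List.in_or_app _ _ _ (or_introl yas)).
exfalso; apply: (L'0 y yas); exists (s' \o x); split=> //.
  by move=> z zL; apply: xl'; apply: List.in_or_app; right.
move=> i ik; apply: aut2 => //.
suff -> : s \o h' i = h i by apply: xh.
apply/funext => z; have := congr1 (fun u => u (i, z)) sE.
by rewrite /stut /= (minn_idPl (ltnW ik)).
Qed.

(** For the [k] of [minc], [partial_broom] holds with an empty list. Each step lowers [k] and shifts
    [V], until [k = 0], where any sequence following [V] yields the list. *)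
Lemma broom X (chi1 chi2 : (X -> M) -> (Y -> M) -> Prop) V k :
  dfn2 N chi1 -> dfn2 N chi2 -> good N a V -> minc N a V k chi2 -> quasi_div chi1 ->
  quasi_div (fun x y => chi1 x y \/ chi2 x y).
Proof.
move=> dchi1 dchi2 gV mV q1.
have : partial_broom (fun x y => chi1 x y \/ chi2 x y) chi2 k V.
  by move=> h mh eh; exists [::]; split=> // -[x [_ xh]]; apply: (mV h mh eh); exists x.
elim: k V gV {mV} => [|k IH] V gV brm; last first.
  by apply: (IH (fun i => V i.+1)); [move=> i; apply: gV|apply: partial_broomS].
have [F [Dn FP]] := @rec_rows _ N (fun n D c => rlz (V n) D c) sY sN
  (fun n D sD _ => let: And3 uV _ _ := gV n in realize M_monster sY sD uV).
have mF : mor N V F.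
  move=> r; have [DD _ Fr FD] := FP r.+1; apply: rlz_mono Fr => x [Nx|[i [y [ir <-]]]].
    exact: DD.
  by apply: (FD i) => //; exists y.
have eF : eqv N a (F 0).
  move=> S dS Sa; have [DD _ F0 _] := FP 0; apply: F0; first exact: dfn_mono dS.
  by have [_ _] := gV 0; apply.
have [l [lP l0]] := brm F mF eF; exists l; split=> // -[x xP].
by apply: l0; exists x.
Qed.

(** Disjuncts are added one at a time by the broom lemma. The empty disjunction is false, so the
    list consisting of [a] starts the induction. *)
Lemma quasi_div_or X (l : seq ((X -> M) -> (Y -> M) -> Prop)) : NTP2 M ->
  (forall chi, chi \inl l -> dfn2 N chi /\ divR N chi a) ->
  quasi_div (fun x y => exists2 chi, chi \inl l & chi x y).
Proof.
move=> ntp2; elim: l => [|chi l IH] lP.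
  by exists [:: a]; split=> [y [<-|]//|[x /(_ a (or_introl erefl)) []]].
have IH' := IH (fun c cl => lP c (or_intror cl)).
have [dchi chid] := lP chi (or_introl erefl).
have [V [k [gV mV]]] := div_coheirs ntp2 dchi chid.
have dl : dfn2 N (fun x y => exists2 c, c \inl l & c x y).
  by apply: (@dfn_exists_in _ _ _ _ _ l (fun c u => c (u \o inl) (u \o inr))) => c cl;
    have [] := lP c (or_intror cl).
have [l' [l'P l'0]] := broom dl dchi gV mV IH'.
exists l'; split=> // -[x xP]; apply: l'0; exists x => y /xP [c [<-|cl] cxy].
  by right.
by left; exists c.
Qed.

End Tuples.
End OverModel.
End DividingMonster.

(** * Pigeonhole principle and increasing sequences of indices *)

Lemma pigeonhole_fiber r k (f : 'I_(r * k).+1 -> 'I_r) :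
  exists c (t : 'I_k -> 'I_(r * k).+1), injective t /\ forall e, f (t e) = c.
Proof.
have [c kc] : exists c, (k <= #|[set i | f i == c]%SET|)%N.
  apply: contrapT => n.
  have le c : (#|[set i | f i == c]%SET| <= k)%N.
    by rewrite leqNgt; apply/negP => /ltnW kc; apply: n; exists c.
  have : (\sum_(c : 'I_r) #|[set i | f i == c]%SET| <= r * k)%N.
    by rewrite -[r in (_ <= r * _)%N]card_ord -sum_nat_const; apply: leq_sum.
  rewrite (_ : \sum_c _ = (r * k).+1) ?ltnn //.
  rewrite -[RHS]card_ord -sum1_card (partition_big f xpredT) //=.
  by apply: eq_bigr => c _; rewrite -sum1_card; apply: eq_bigl => i; rewrite inE.
exists c, (fun e => enum_val (widen_ord kc e)); split.
  by move=> e e' /enum_val_inj /(congr1 val) /= /val_inj.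
by move=> e; have := enum_valP (widen_ord kc e); rewrite inE => /eqP.
Qed.

Lemma sorted_enum k (s : 'I_k -> nat) : injective s ->
  exists2 u : 'I_k -> nat, {homo u : i j / (i < j)%N} & forall e, exists e', u e = s e'.
Proof.
move=> si; pose l := sort leq (codom s).
have sl : size l = k by rewrite size_sort size_codom card_ord.
have ul : uniq l by rewrite sort_uniq; apply/injectiveP.
have so : sorted ltn l by rewrite ltn_sorted_uniq_leq ul sort_sorted //; apply: leq_total.
exists (fun e => nth 0 l e) => [i j ij|e].
  by rewrite (sorted_ltn_nth ltn_trans) // inE sl.
have : nth 0 l e \in codom s by rewrite -(mem_sort leq) mem_nth // sl.
by move=> /codomP [e' ->]; exists e'.
Qed.

(** Needed because [mor] concerns infinite sequences; past the last index the values go on from a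
    bound [m] on those of [s]. *)
Lemma homo_extension n (s : 'I_n -> nat) : {homo s : i j / (i < j)%N} ->
  exists2 u : nat -> nat, {homo u : i j / (i < j)%N} & forall e, u (val e) = s e.
Proof.
move=> sh; pose m := (\max_e s e).+1.
exists (fun i => if insub i is Some e then s e else m + i) => [i j ij|e]; last by rewrite valK.
case: insubP => [e ein eE|]; case: insubP => [e' e'in e'E|] //=.
- by apply: sh; rewrite /= eE e'E.
- by move=> _; rewrite ltn_addr // ltnS (leq_bigmax e).
- by rewrite -leqNgt => ni; move: (leq_ltn_trans ni ij); rewrite ltnNge (ltnW e'in).
- by rewrite ltn_add2l.
Qed.

(** * Kim's lemma and indiscernible witnesses of dividing *)

Section Witnesses.
Context (L : language) (T : set (sentence L)) (K : Type) (M : structure L).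
Hypothesis M_monster : monster_model M K T.
Implicit Types A C D N : set M.

Local Notation sm := (sm K).

(* The row is found with the help of a witness [ds] of dividing: as the formulas of
   the type of [D] over [a] do not divide, they are consistent along many [ds j]. *)
Lemma nondividing_row C D X Y (U : set (set (Y -> M))) (a : Y -> M)
    (phi : (X -> M) -> (Y -> M) -> Prop) k (ds : nat -> Y -> M) :
  sm D -> sm Y -> C `<=` D -> ultra U ->
  (forall R : (D -> M) -> (Y -> M) -> Prop, dfn2 C R -> U [set y | R val y] -> ~ divR C R a) ->
  dfn2 C phi -> (forall j, eqv C a (ds j)) -> kinc k (fun j x => phi x (ds j)) ->
  exists G : nat * Y -> M, (forall j, rlz U D (fun y => G (j, y))) /\
    kinc k (fun j x => phi x (fun y => G (j, y))).
Proof.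
move=> sD sY CD uU ndiv dphi dsP inc.
pose inc_up r (G : nat * Y -> M) := forall s : {ffun 'I_k -> 'I_r}, injective s ->
  ~ exists x, forall i, phi x (fun y => G (val (s i), y)).
have dinc r : dfn C (inc_up r).
  apply: dfn_forall_fin => s; apply: dfn_imp (dfn_cst _ _ _) _; apply: dfn_not.
  apply: (dfn2_ex (R := fun G x => forall i, phi x (fun y => G (val (s i), y)))).
  apply: dfn_forall_fin => i.
  by apply: (dfn2_sub (f := fun v => v \o inr) (g := fun v y => v (inl (val (s i), y))) _ _ dphi); coords.
(* Finite approximations to the desired row; the main point is that each is nonempty. *)
pose base R r := [set G | (forall j : 'I_r, R (fun y => G (val j, y))) /\ inc_up r G].
have dbase (R : set (Y -> M)) r : dfn D R -> dfn D (base R r).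
  move=> dR; apply: dfn_and; last exact: dfn_mono (dinc r).
  apply: dfn_forall_fin => j.
  by apply: (dfn_sub (h := fun (G : nat * Y -> M) y => G (val j, y)) _ dR); coords.
have [||| W [uW BW]] := @directed_ultra _ [set P | exists R r, [/\ dfn D R, U R & P = base R r]].
- by exists (base setT 0), setT, 0; split=> //; [apply: (dfn_cst D Y True)|apply: ultraT].
- move=> P [R [r [dR UR ->]]].
  have [|R0 dR0 R0P] := @dfn_abs _ _ C _ _ (val : D -> M) R.
    by apply: dfn_mono dR => x Dx; right; exists (SigSub (mem_set Dx)).
  pose E (x : D -> M) := exists G, (forall j : 'I_r, R0 (fun y => G (val j, y)) x) /\ inc_up r G.
  have dE : dfn C E.
    apply: (dfn2_ex (R := fun x G => (forall j : 'I_r, R0 (fun y => G (val j, y)) x) /\ inc_up r G)).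
    apply: dfn_and; last exact: (dfn_comp inr (dinc r)).
    apply: dfn_forall_fin => j.
    by apply: (dfn2_sub (f := fun v y => v (inr (val j, y))) (g := fun v => v \o inl) _ _ dR0); coords.
  suff [G [GR Gi]] : E val by exists G; split=> // j; apply/R0P.
  (* Otherwise [R1] belongs to [U] and so may not divide at [a]. It does divide along [ds]: a common
     solution [x] for enough of the [ds] would have these as an approximation, against [~ E x]. *)
  apply: contrapT => nE; pose R1 x y := R0 y x /\ ~ E x.
  apply: (ndiv R1).
  + apply: dfn_and; last exact: (dfn_comp inl (dfn_not dE)).
    by apply: (dfn2_sub (f := fun v => v \o inr) (g := fun v => v \o inl) _ _ dR0); coords.
  + by apply: ultraS UR => // y /R0P.
  (* One instance more than [r] provides [ord0], also for [r = 0], and lets [inord] index the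
     approximation. *)
  exists r.+1, ds; split=> // s si [x xP].
  have [_] := xP ord0; apply; exists (fun z => ds (s (inord z.1)) z.2); split.
    by move=> j; have [] := xP (inord j).
  move=> t ti [x' x'P]; apply: (inc (fun i => s (inord (t i)))); last by exists x'.
  move=> i i' /si /(congr1 (@nat_of_ord _)); rewrite !inordK ?ltnS ?(ltnW (ltn_ord _)) //.
  by move=> /val_inj /ti.
- move=> P P' [R [r [dR UR ->]]] [R' [r' [dR' UR' ->]]].
  exists (base (R `&` R') (maxn r r')).
    by exists (R `&` R'), (maxn r r'); split=> //; [apply: dfn_and|apply: ultraI].
  move=> G [GR Gi]; have incW q : (q <= maxn r r')%N -> inc_up q G.
    move=> qr s si [x xP]; apply: (Gi [ffun i => widen_ord qr (s i)]).
      by move=> i i'; rewrite !ffunE => /(congr1 val) /= /val_inj /si.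
    by exists x => i; rewrite ffunE; apply: xP.
  split; split; try by apply: incW; rewrite ?leq_maxl ?leq_maxr.
    by move=> j; have [] := GR (widen_ord (leq_maxl _ _) j).
  by move=> j; have [] := GR (widen_ord (leq_maxr _ _) j).
have sI : sm (nat * Y) by apply: (small_prod M_monster) => //; apply: (small_nat M_monster).
have [G GP] := realize M_monster sI sD uW.
have GB R r : dfn D R -> U R -> base R r G.
  by move=> dR UR; apply: GP; [apply: dbase|apply: BW; exists R, r].
exists G; split=> [j S dS US|s si [x xP]].
  by have [h _] := GB S j.+1 dS US; apply: (h ord_max).
have [|| _ Gi] := GB setT (\max_e s e).+1; [apply: (dfn_cst D Y True)|exact: ultraT|].
have sm_ e : (s e < (\max_e s e).+1)%N by rewrite ltnS (leq_bigmax e).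
apply: (Gi [ffun e => Ordinal (sm_ e)]); first by move=> i i'; rewrite !ffunE => -[/si].
by exists x => i; rewrite ffunE; apply: xP.
Qed.

Section OverModel.
Context (N : set M).
Hypotheses (sN : sm N) (mN : submodel N) (ntp2 : NTP2 M).

(* In [R], the first tuple is indexed by [M] itself and is instantiated with [id], so
   that [R id y] is an arbitrary L(M)-condition on [y]. *)
Definition strict Y (a : Y -> M) (U : set (set (Y -> M))) : Prop :=
  [/\ ultra U, coh N U, forall S, dfn N S -> S a -> U S &
      forall R : (M -> M) -> (Y -> M) -> Prop, dfn2 N R -> divR N R a -> ~ U [set y | R id y]].

(** By compactness, it is enough to find in [N] a tuple in [S] at which [id] fails finitely many
    dividing formulas. Their disjunction quasi-divides, and the finite list showing this can be
    copied into [N]; since no tuple satisfies the disjunction along the copy, [id] fails it at some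
    member. *)
Lemma strict_coheir Y (a : Y -> M) : sm Y -> exists U, strict a U.
Proof.
move=> sY.
pose NY := [set y : Y -> M | forall i, N (y i)].
pose divs := [set R : (M -> M) -> (Y -> M) -> Prop | dfn2 N R /\ divR N R a].
pose B := [set S : set (Y -> M) | dfn N S /\ S a] `|` [set NY] `|`
  [set P | exists2 R, divs R & P = [set y | ~ R id y]].
have [|U [uU BU]] := @fip_ultra _ B.
  move=> l lB.
  have [S [l' [dS Sa l'P lP]]] : exists S (l' : seq ((M -> M) -> (Y -> M) -> Prop)),
      [/\ dfn N S, S a, forall R, R \inl l' -> divs R &
       forall y, NY y -> S y -> (forall R, R \inl l' -> ~ R id y) -> forall P, P \inl l -> P y].
    elim: l lB => [|P l IH] lB; first by exists setT, [::]; split=> //; apply: (dfn_cst N Y True).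
    have [S [l' [dS Sa l'P lP]]] := IH (fun Q Ql => lB Q (or_intror Ql)).
    case: (lB P (or_introl erefl)) => [[[dP Pa]|PN]|[R divsR PR]].
    - exists (S `&` P), l'; split=> //; first exact: dfn_and.
      by move=> y Ny [Sy Py] Ry Q [<-//|]; apply: lP.
    - exists S, l'; split=> // y Ny Sy Ry Q [<-|]; first by rewrite PN.
      exact: lP.
    - exists S, (R :: l'); split=> // [Q [<-//|/l'P//]|y Ny Sy Ry Q [<-|]].
        by rewrite PR; apply: Ry; left.
      by apply: lP => // Q' Q'l; apply: Ry; right.
  suff [y [Ny Sy Ry]] : exists y, [/\ NY y, S y & forall R, R \inl l' -> ~ R id y].
    by exists y; apply: lP.
  apply: contrapT => ny.
  have [lq [lqP lq0]] := quasi_div_or M_monster sN mN sY ntp2 l'P.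
  pose S' (u : 'I_(size lq) * Y -> M) := (forall i, S (fun y => u (i, y))) /\
    ~ exists x : M -> M, forall i, exists2 R, R \inl l' & R x (fun y => u (i, y)).
  have dS' : dfn N S'.
    apply: dfn_and.
      apply: dfn_forall_fin => i.
      by apply: (dfn_sub (h := fun (u : 'I_(size lq) * Y -> M) y => u (i, y)) _ dS); coords.
    apply: dfn_not.
    apply: (dfn2_ex (R := fun u x => forall i, exists2 R, R \inl l' & R x (fun y => u (i, y)))).
    apply: dfn_forall_fin => i.
    apply: (@dfn_exists_in _ _ _ _ _ l' (fun R v => R (v \o inr) (fun y => v (inl (i, y))))) => R Rl.
    have [dR _] := l'P R Rl.
    by apply: (dfn2_sub (f := fun v => v \o inr) (g := fun v y => v (inl (i, y))) _ _ dR); coords.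
  have lqI i : (i < size lq)%N -> nth a lq i \inl lq.
    by elim: lq {lqP lq0 S' dS'} i => // y lq IH [|i] //= il; [left|right; apply: IH].
  have [|u Nu [uS u0]] := submodelP mN dS'.
    exists (fun z => nth a lq (nat_of_ord z.1) z.2); split=> [i|[x xP]].
      exact: (lqP _ (lqI i (ltn_ord i))) dS Sa.
    apply: lq0; exists x => y yl; have := xP (Ordinal (pos_size yl)).
    by rewrite /= (_ : (fun z => _) = y) //; apply/funext => z; rewrite nth_pos.
  apply: u0; exists id => i; apply: contrapT => nR; apply: ny.
  by exists (fun y => u (i, y)); split=> // R Rl Ru; apply: nR; exists R.
exists U; split=> //.
- move=> P UP; have UN : U NY by apply: BU; left; right.
  by have [y [Py Ny]] := ultra_ex uU (ultraI uU UP UN); exists y.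
- by move=> S dS Sa; apply: BU; left; left.
- by move=> R dR divR_; apply/(ultraC _ uU); apply: BU; right; exists R.
Qed.

(** Kim's lemma. The rows of the array are inconsistent sequences of realizations of [U], given by
    [nondividing_row], and every path is a Morley sequence of [U]. If these were consistent at every
    length, the array would witness [TP2]. *)
Lemma kim X Y (a : Y -> M) U (phi : (X -> M) -> (Y -> M) -> Prop) : sm Y -> strict a U ->
  dfn2 N phi -> divR N phi a -> exists k, minc N a (fun=> U) k phi.
Proof.
move=> sY [uU cU aU sU] dphi [k [ds [dsP inc]]].
have sI : sm (nat * Y) by apply: (small_prod M_monster) => //; apply: (small_nat M_monster).
have [|F [Dn FP]] := @rec_rows _ _ K M M_monster _ N (fun _ D G =>
    (forall j, rlz U D (fun y => G (j, y))) /\ kinc k (fun j x => phi x (fun y => G (j, y)))) sI sN.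
  move=> _ D sD ND; apply: (nondividing_row (C := N) (a := a) (ds := ds)) => // R dR UR dvR.
  apply: (sU (fun x y => R (x \o val) y)) UR; last exact: divR_comp.
  by apply: (dfn2_sub (f := fun v => v \o inl \o val) (g := fun v => v \o inr) _ _ dR); coords.
apply: contrapT => nk; apply: ntp2.
apply: (TP2_intro (k := k) (a := fun i j y => F i (j, y)) dphi) => [i|eta n].
  by have [_ _ [_]] := FP i.
have [h [mh eh hx]] : exists h, [/\ mor N (fun=> U) h, eqv N a (h 0) &
    exists x, forall i, (i < n)%N -> phi x (h i)].
  apply: contrapT => nh; apply: nk; exists n => h mh eh hx; apply: nh; by exists h.
pose g i y := F i (eta i, y).
have gV : good N a (fun=> U) by move=> i; split.
apply: (mor_transfer (g := g) dphi gV _ _ mh eh hx).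
  move=> r; have [ND _ [Fr _] FD] := FP r.+1; apply: rlz_mono (Fr (eta r.+1)).
  move=> x [/ND//|[i [y [ir <-]]]]; apply: (FD i) => //; by exists (eta i, y).
move=> S dS Sa; have [ND _ [F0 _] _] := FP 0.
by apply: (F0 (eta 0)); [apply: dfn_mono dS|apply: aU].
Qed.

End OverModel.

(** Passes from infinite tuples to the finite ones in [formula_divides]: the tuple [b] collects the
    coordinates of [a] and the constants of [A] that the formula mentions. *)
Lemma divR_formula A X Y (chi : (X -> M) -> (Y -> M) -> Prop) (a : Y -> M) :
  sm A -> sm Y -> dfn2 A chi -> divR A chi a ->
  exists2 theta : formula L (X + M), formula_divides A theta & forall c, holds c theta <-> chi c a.
Proof.
move=> sA sY [psi psiP] [k [ds [dsP inc]]].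
have [l lP] := sat_supp M psi; have [m0] := carrier_inhabited M.
pose f (z : (X + Y) + A) : X + 'I_(size l).+1 := if z is inl (inl x) then inl x else inr (posI l z).
have key (b : 'I_(size l).+1 -> M) (y : Y -> M) :
    (forall i, inl (inr i) \inl l -> b (posI l (inl (inr i))) = y i) ->
    (forall m : A, inr m \inl l -> b (posI l (inr m)) = val m) ->
    forall x, sat (join x b) (rename f psi) <-> chi x y.
  move=> bY bA x; have := psiP (join x y); rewrite sat_rename => ->.
  by apply: lP => -[[z|z]|z] //= zl; [apply: bY|apply: bA].
pose b (e : 'I_(size l).+1) := nth m0 (map (join (join (fun=> m0) a) (val : A -> M)) l) e.
have bP := key b a.
exists (inst (rename f psi) b); last first.
  by move=> c; rewrite holds_inst; apply: bP => z zl; rewrite /b nth_posI.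
have /choice[s sP] : forall j, exists s, aut A s /\ s \o a = ds j.
  by move=> j; have [s sAut <-] := eqv_aut M_monster sA sY (dsP j); exists s.
exists (size l).+1, (rename f psi), b; split=> //; exists k, (fun j => s j \o b); split.
  by move=> j; apply/tp_eqv; apply: eqv_sym; apply: aut_eqv; case: (sP j).
move=> t ti [x xP]; apply: (inc t ti); exists x => i.
have [[sAut sA'] se] := sP (t i).
have /holds_inst := xP i; apply: (iffLR (key _ _ _ _ _)) => z zl /=.
  by rewrite /b nth_posI // -se.
by rewrite /b nth_posI //= sA' //; apply: set_valP.
Qed.

Lemma complete_tp A I (d : I -> M) : complete_type A (tp d A).
Proof.
split; first by move=> theta [].
  move=> [n [theta [th none]]]; apply: (none d) => i; by have [] := th i.
move=> theta oth; have [h|h] := pselect (holds d theta); first by left.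
by right; split; [apply: over_not|].
Qed.

(* [extension_base] for the type of an infinite tuple [d]: otherwise the formula
   forall y, S y -> (some R in l holds) would make tp(d/A) fork. *)
Lemma extension_base_tuple A X Y (a : Y -> M) (d : X -> M) (S : set (Y -> M))
    (l : seq ((X -> M) -> (Y -> M) -> Prop)) : extension_base A -> sm A -> sm Y ->
  dfn A S -> S a -> (forall R, R \inl l -> dfn2 A R /\ divR A R a) ->
  exists2 y, S y & forall R, R \inl l -> ~ R d y.
Proof.
move=> base sA sY dS Sa lP; apply: contrapT => ny.
have cov y : S y -> exists2 R, R \inl l & R d y.
  by move=> Sy; apply: contrapT => nR; apply: ny; exists y => // R Rl Rdy; apply: nR; exists R.
(* [extension_base] speaks of finite tuples, so [d] is restricted to the finite list [lx] of
   coordinates that the formulas depend on, and [lift] quantifies over the remaining ones. *)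
have [lx lxP] : exists lx : seq X, forall R, R \inl l -> forall x x' y,
    (forall i, i \inl lx -> x i = x' i) -> R x y -> R x' y.
  elim: l lP {ny cov} => [|R l IH] lP; first by exists [::].
  have [lx lxP] := IH (fun Q Ql => lP Q (or_intror Ql)).
  have [dR _] := lP R (or_introl erefl); have [lr lrP] := dfn_supp dR.
  exists (List.flat_map (fun z => if z is inl i then [:: i] else [::]) lr ++ lx)%list.
  move=> Q [<-|Ql] x x' y xx; last first.
    by apply: lxP => // i il; apply: xx; apply: List.in_or_app; right.
  apply: (iffLR (lrP (join x y) (join x' y) _)) => -[i|i] //= il; apply: xx.
  by apply: List.in_or_app; left; apply/List.in_flat_map; exists (inl i); split=> //; left.
pose p : 'I_(size lx) -> X := tnth (in_tuple lx).
pose up (x' : 'I_(size lx) -> M) (x : X -> M) := forall e, x (p e) = x' e.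
have upP x' x1 x2 i : up x' x1 -> up x' x2 -> i \inl lx -> x1 i = x2 i.
  move=> h1 h2 il; have -> : i = p (Ordinal (pos_size il)) by rewrite /p (tnth_nth i) /= nth_pos.
  by rewrite h1 h2.
pose lift (R : (X -> M) -> (Y -> M) -> Prop) x' y := exists x, up x' x /\ R x y.
have dlift R : dfn2 A R -> dfn2 A (lift R).
  move=> dR; apply: (dfn2_ex (R := fun (v : 'I_(size lx) + Y -> M) x => up (v \o inl) x /\ R x (v \o inr))).
  apply: dfn_and; first by apply: dfn_forall_fin => e; apply: dfn_eq.
  by apply: (dfn2_sub (f := fun v => v \o inr) (g := fun v => v \o inl \o inr) _ _ dR); coords.
have divlift R : R \inl l -> divR A (lift R) a.
  move=> Rl; have [_ [k [ds [dsP inc]]]] := lP R Rl.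
  exists k, ds; split=> // s si [x' /choice[x xP]]; apply: (inc s si).
  have [[i0 _]|n0] := pselect (exists i : 'I_k, True).
    exists (x i0) => i; have [u1 _] := xP i0; have [u2 Ri] := xP i.
    by apply: lxP Ri => // z zl; apply: (upP x').
  have [m0] := carrier_inhabited M.
  by exists (fun=> m0) => i; case: n0; exists i.
apply: (base _ _ (complete_tp A (d \o p))).
pose R0 (x : X -> M) (y : Y -> M) := False.
have /choice[th thP] : forall i : 'I_(size l), exists theta, formula_divides A theta /\
    forall c, holds c theta <-> lift (nth R0 l i) c a.
  move=> i; have Rl : nth R0 l i \inl l.
    case: i => i /=; elim: l i {lP ny cov lxP divlift} => // R l IH [|i] //= il; [by left|right].
    exact: IH.
  have [dR _] := lP _ Rl.
  by have [th] := divR_formula sA sY (dlift _ dR) (divlift _ Rl); exists th.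
exists (size l), th; split=> [i|]; first by have [] := thP i.
apply: (tp_implies (R := fun x' => exists x, up x' x /\ forall y, S y -> exists2 R, R \inl l & R x y)).
- apply: (dfn2_ex (R := fun x' x => up x' x /\ forall y, S y -> exists2 R, R \inl l & R x y)).
  apply: dfn_and; first by apply: dfn_forall_fin => e; apply: dfn_eq.
  apply: (dfn_comp inr (S := fun x : X -> M => forall y, S y -> exists2 R, R \inl l & R x y)).
  apply: (dfn2_all (R := fun x y => S y -> exists2 R, R \inl l & R x y)).
  apply: dfn_imp; first exact: (dfn_comp inr dS).
  by apply: (@dfn_exists_in _ _ _ _ _ l (fun R u => R (u \o inl) (u \o inr))) => R /lP [].
- by exists d.
- move=> x' [x [ux xS]]; have [R Rl Rxa] := xS a Sa.
  exists (Ordinal (pos_size Rl)); have [_ h] := thP (Ordinal (pos_size Rl)); apply/h.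
  by exists x; split=> //=; rewrite nth_pos.
Qed.

(** [a] is replaced by a conjugate [a'] over [A] such that the formulas still divide over the model
    [N]. A Morley sequence of a strict coheir then makes each disjunct inconsistent, and the
    pigeonhole principle handles their disjunction. *)
Lemma dividing_sequence A X Y (a : Y -> M) (l : seq ((X -> M) -> (Y -> M) -> Prop)) :
  NTP2 M -> extension_base A -> sm A -> sm Y ->
  (forall chi, chi \inl l -> dfn2 A chi /\ divR A chi a) ->
  exists k (c : nat -> Y -> M), [/\ forall j, eqv A a (c j),
    forall n (s t : 'I_n -> nat), {homo s : i j / (i < j)%N} -> {homo t : i j / (i < j)%N} ->
      eqv A (fun z : 'I_n * Y => c (s z.1) z.2) (fun z => c (t z.1) z.2) &
    kinc k (fun j x => exists2 chi, chi \inl l & chi x (c j))].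
Proof.
move=> ntp2 base sA sY lP.
have [N [sN AN mN]] := small_submodel M_monster sA.
pose divs := [set R : (N -> M) -> (Y -> M) -> Prop | dfn2 A R /\ divR A R a].
pose B := [set S : set (Y -> M) | dfn A S /\ S a] `|`
  [set P | exists2 R, divs R & P = [set y | ~ R val y]].
(* [U'] extends the type of [a] over [A] and avoids each [R val y] for which [R x a] divides over
   [A]; [extension_base_tuple] gives the finite consistency. *)
have [|U' [uU' BU']] := @fip_ultra _ B.
  move=> q qB.
  have [S [l' [dS Sa l'P qP]]] : exists S (l' : seq ((N -> M) -> (Y -> M) -> Prop)),
      [/\ dfn A S, S a, forall R, R \inl l' -> divs R &
       forall y, S y -> (forall R, R \inl l' -> ~ R val y) -> forall P, P \inl q -> P y].
    elim: q qB => [|P q IH] qB; first by exists setT, [::]; split=> //; apply: (dfn_cst A Y True).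
    have [S [l' [dS Sa l'P qP]]] := IH (fun Q Ql => qB Q (or_intror Ql)).
    case: (qB P (or_introl erefl)) => [[dP Pa]|[R divsR PR]].
    - exists (S `&` P), l'; split=> //; first exact: dfn_and.
      by move=> y [Sy Py] Ry Q [<-//|]; apply: qP.
    - exists S, (R :: l'); split=> // [Q [<-//|/l'P//]|y Sy Ry Q [<-|]].
        by rewrite PR; apply: Ry; left.
      by apply: qP => // Q' Q'l; apply: Ry; right.
  have [y Sy yR] := extension_base_tuple val base sA sY dS Sa l'P.
  by exists y; apply: qP.
have nd (R : (N -> M) -> (Y -> M) -> Prop) : dfn2 A R -> U' [set y | R val y] -> ~ divR A R a.
  by move=> dR UR dvR; move: UR; apply/(ultraC _ uU'); apply: BU'; right; exists R.
have [a' a'P] := realize M_monster sY sN uU'.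
have ea' : eqv A a a'.
  by move=> S dS Sa; apply: a'P; [apply: dfn_mono dS|apply: BU'; left].
have lPN chi : chi \inl l -> dfn2 N chi /\ divR N chi a'.
  move=> /lP [dchi [k [ds [dsP inc]]]]; split; first exact: dfn_mono dchi.
  (* The row consists of realizations of [U'] over [N], hence of conjugates of [a'] over [N]:
     dividing over [A] becomes dividing over [N]. *)
  have [G [GU Ginc]] := nondividing_row sN sY AN uU' nd dchi dsP inc.
  by exists k, (fun j y => G (j, y)); split=> // j; apply: (rlz_eqv uU' (@subset_refl _ N)).
have [U sU] := strict_coheir sN mN ntp2 a' sY; have [uU cU aU _] := sU.
have [k0 k0P] : exists k, forall chi, chi \inl l -> minc N a' (fun=> U) k chi.
  elim: l lPN {lP} => [|chi l IH] lPN; first by exists 0.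
  have [k kP] := IH (fun c cl => lPN c (or_intror cl)).
  have [dchi chid] := lPN chi (or_introl erefl).
  have [k' k'P] := kim sN ntp2 sY sU dchi chid.
  exists (maxn k k') => c [<-|cl] h mh eh [x xP].
    by apply: (k'P h mh eh); exists x => i ik; apply: xP; rewrite leq_max ik orbT.
  by apply: (kP c cl h mh eh); exists x => i ik; apply: xP; rewrite leq_max ik.
have [F [Dn FP]] := @rec_rows _ _ _ _ M_monster _ N (fun n D c => rlz U D c) sY sN
  (fun n D sD _ => realize M_monster sY sD uU).
have eF j : eqv N a' (F j).
  move=> S dS Sa; have [ND _ Fj _] := FP j; apply: Fj; first exact: dfn_mono dS.
  exact: aU.
have morF (u : nat -> nat) : {homo u : i j / (i < j)%N} -> mor N (fun=> U) (F \o u).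
  move=> uh r; have [ND _ Fr FD] := FP (u r.+1); apply: rlz_mono Fr => x [/ND//|[i [y [ir <-]]]].
  by apply: (FD (u i)); [apply: uh|exists y].
(* Among so many satisfied disjunctions, [k0] are satisfied through the same disjunct, against the
   choice of [k0]. *)
exists (size l * k0).+1, F; split.
- by move=> j; apply: eqv_trans ea' (eqv_mono AN (eF j)).
- move=> n s t sh th; have [u uh us] := homo_extension sh; have [v vh vt] := homo_extension th.
  have e0 : eqv N ((F \o u) 0) ((F \o v) 0) := eqv_trans (eqv_sym (eF _)) (eF _).
  have e := @mor_eqv _ _ N Y (fun=> U) _ _ (fun=> uU) (fun=> cU) (morF u uh) (morF v vh) e0 n.
  have := eqv_comp (f := fun z : 'I_n * Y => (val z.1, z.2)) (eqv_mono AN e).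
  rewrite (_ : stut n (F \o u) \o _ = fun z => F (s z.1) z.2); last first.
    by apply/funext => -[i y]; rewrite /stut /= (minn_idPl (ltnW (ltn_ord i))) us.
  rewrite (_ : stut n (F \o v) \o _ = fun z => F (t z.1) z.2) //.
  by apply/funext => -[i y]; rewrite /stut /= (minn_idPl (ltnW (ltn_ord i))) vt.
- move=> s si [x xP].
  pose R0 (x : X -> M) (y : Y -> M) := False.
  have /choice[f fP] : forall e, exists c : 'I_(size l), nth R0 l c x (F (s e)).
    move=> e; have [chi cl cx] := xP e.
    by exists (Ordinal (pos_size cl)); rewrite /= nth_pos.
  have [c [t [ti tc]]] := pigeonhole_fiber f.
  have [w wh wP] := @sorted_enum k0 (s \o t) (inj_comp si ti).
  have [u uh uw] := homo_extension wh.
  have cl : nth R0 l c \inl l.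
    case: c {tc} => c /=; elim: l c {lP lPN k0P s si xP f fP t ti w wh wP uw} => // R l IH [|i] //= il; [by left|right].
    exact: IH.
  apply: (k0P _ cl (F \o u) (morF u uh)); first exact: eF.
  exists x => i ik; have [e' eE] := wP (Ordinal ik).
  by rewrite /= (uw (Ordinal ik)) eE /= -(tc e'); apply: fP.
Qed.

End Witnesses.

(** * Global types as ultrafilters of tuples *)

Section GlobalTypes.
Context (L : language) (M : structure L).

Lemma type_ultra I (p : set (formula L (I + M))) : global_type p ->
  exists W, ultra W /\ forall theta, Defs.over setT theta -> p theta <-> W [set c | holds c theta].
Proof.
move=> [pover pcons pcomp].
have [|W [uW BW]] := @fip_ultra _ [set P | exists2 theta, p theta & P = [set c : I -> M | holds c theta]].
  move=> l lB; apply: contrapT => nx; apply: pcons.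
  have /choice[th thP] : forall i : 'I_(size l), exists theta, p theta /\
      nth setT l i = [set c : I -> M | holds c theta].
    move=> i; suff /lB [theta pt ->] : nth setT l i \inl l by exists theta.
    case: i => i /=; elim: l i {lB nx} => // P l IH [|i] //= il; [by left|right].
    exact: IH.
  exists (size l), th; split=> [i|c cP]; first by have [] := thP i.
  apply: nx; exists c => P Pl; have [_ h] := thP (Ordinal (pos_size Pl)).
  by move: (cP (Ordinal (pos_size Pl))) h; rewrite /= nth_pos // => + ->.
exists W; split=> // theta oth; split=> [pt|Wt]; first by apply: BW; exists theta.
have [//|pn] := pcomp theta oth.
have /(ultraC _ uW) // : W (~` [set c | holds c theta]) by apply: BW; exists (Not theta).
Qed.

Lemma ultra_type I (W : set (set (I -> M))) : ultra W ->
  global_type [set theta | Defs.over setT theta /\ W [set c | holds c theta]].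
Proof.
move=> uW; split.
- by move=> theta [].
- move=> [n [theta [th th0]]].
  have [x xP] := ultra_ex uW (ultra_forall_fin uW (fun i => (th i).2)).
  exact: th0 xP.
- move=> theta oth; have [h|h] := ultra_or uW [set c | holds c theta]; first by left.
  by right; split; [apply: over_not|].
Qed.

Lemma formula_divides_divR A I (theta : formula L (I + M)) : formula_divides A theta ->
  exists m (phi : (I -> M) -> ('I_m -> M) -> Prop) d,
    [/\ dfn2 A phi, divR A phi d & forall c, holds c theta <-> phi c d].
Proof.
move=> [m [phi [d [-> [k [ds [dsP inc]]]]]]].
exists m, (fun x y => sat (join x y) phi), d; split.
- exists (rename inl phi) => c; rewrite sat_rename; set u := join _ _; set v := _ \o _.
  by suff -> : u = v by []; apply/funext => -[].
- exists k, ds; split=> [j|s si [x xP]]; first by apply/tp_eqv; rewrite dsP.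
  by apply: (inc s si); exists x => i; apply/holds_inst.
- by move=> c; rewrite holds_inst.
Qed.

End GlobalTypes.

(** * Symmetry: from [ist] to [st] *)

Section Symmetry.
Context (L : language) (T : set (sentence L)) (K : Type) (M : structure L).
Hypothesis M_monster : monster_model M K T.
Context (A : set M) (I J : Type) (a : I -> M) (b : J -> M).

Local Notation sm := (sm K).

Hypotheses (M_NTP2 : NTP2 M) (A_base : extension_base A) (sA : sm A) (sI : sm I) (sJ : sm J).

(** The sequence must start at [b] itself, since strong splitting will compare [b] with the other
    terms; an automorphism over [A] moves the sequence of [dividing_sequence] there. *)
Lemma dividing_sequence_from X (l : seq ((X -> M) -> (J -> M) -> Prop)) :
  (forall chi, chi \inl l -> dfn2 A chi /\ divR A chi b) ->
  exists k (c : nat -> J -> M), [/\ c 0 = b,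
    forall n (s t : 'I_n -> nat), {homo s : i j / (i < j)%N} -> {homo t : i j / (i < j)%N} ->
      eqv A (fun z : 'I_n * J => c (s z.1) z.2) (fun z => c (t z.1) z.2) &
    kinc k (fun j x => exists2 chi, chi \inl l & chi x (c j))].
Proof.
move=> lP; have [k [c [eqc ind inc]]] := dividing_sequence M_monster M_NTP2 A_base sA sJ lP.
have [s sAut sE] := eqv_aut M_monster sA sJ (eqv_sym (eqc 0)).
have [s' [s'Aut sK s'K]] := aut_inv sAut.
exists k, (fun j => s \o c j); split=> //.
- move=> n u v uh vh; apply: eqv_trans (aut_eqv sAut).
  by apply: eqv_trans (ind n u v uh vh); apply: eqv_sym; apply: aut_eqv.
- move=> t ti [x xP]; apply: (inc t ti); exists (s' \o x) => i.
  have [chi cl cx] := xP i; exists chi => //; have [dchi _] := lP chi cl.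
  apply: (iffLR (dfn_aut (join (s' \o x) (c (t i))) sAut dchi)) => /=.
  move: cx; congr chi; apply/funext => z /=; by rewrite s'K.
Qed.

(* With [R] large, some [x i] with [i < R] is not ruled out by any [chi (d j)];
   it then satisfies a dividing disjunction along too many [e j]. *)
Lemma ist_realizes Z (d : Z -> M) (theta : (J -> M) -> (I -> M) -> Prop)
    (lphi : seq ((J -> M) -> (Z -> M) -> Prop)) (lchi : seq ((Z -> M) -> (J -> M) -> Prop)) :
  ist K A a b -> sm Z -> dfn2 A theta -> theta b a ->
  (forall phi, phi \inl lphi -> dfn2 A phi /\ divR A phi d) ->
  (forall chi, chi \inl lchi -> dfn2 A chi /\ divR A chi b) ->
  exists x, [/\ theta x a, forall phi, phi \inl lphi -> ~ phi x d &
    forall chi, chi \inl lchi -> ~ chi d x].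
Proof.
move=> [p [pglob pa nsplit pdiv]] sZ dtheta tba lphiP lchiP; apply: contrapT => nx.
(* If no [x] is as required, every [x] is covered; this is a property of [a] and [d] over [A], so it
   passes to every conjugate [es j] of the pair. *)
pose cover (x : J -> M) (e : I + Z -> M) := theta x (e \o inl) ->
  (exists2 phi, phi \inl lphi & phi x (e \o inr)) \/ (exists2 chi, chi \inl lchi & chi (e \o inr) x).
have cov0 x : cover x (join a d).
  move=> tx; apply: contrapT => nc; apply: nx; exists x; split=> // [phi pl px|chi cl cx]; apply: nc.
    by left; exists phi.
  by right; exists chi.
have dcover : dfn A (fun e => forall x, cover x e).
  apply: (dfn2_all (R := fun e x => cover x e)); apply: dfn_imp.
    by apply: (dfn2_sub (f := fun v => v \o inr) (g := fun v => v \o inl \o inl) _ _ dtheta); coords.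
  apply: dfn_or.
    apply: (@dfn_exists_in _ _ _ _ _ lphi (fun R v => R (v \o inr) (v \o inl \o inr))) => R /lphiP [dR _].
    by apply: (dfn2_sub (f := fun v => v \o inr) (g := fun v => v \o inl \o inr) _ _ dR); coords.
  apply: (@dfn_exists_in _ _ _ _ _ lchi (fun R v => R (v \o inl \o inr) (v \o inr))) => R /lchiP [dR _].
  by apply: (dfn2_sub (f := fun v => v \o inl \o inr) (g := fun v => v \o inr) _ _ dR); coords.
pose wide (phi : (J -> M) -> (Z -> M) -> Prop) x (e : I + Z -> M) := phi x (e \o inr).
have [|kf [es [eqe _ ince]]] := dividing_sequence M_monster (a := join a d)
    (l := List.map wide lphi) M_NTP2 A_base sA (small_sum M_monster sI sZ).
  move=> _ /List.in_map_iff [phi [<- pl]]; have [dphi dvphi] := lphiP phi pl.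
  have dw : dfn2 A (wide phi).
    by apply: (dfn2_sub (f := fun v => v \o inl) (g := fun v => v \o inr \o inr) _ _ dphi); coords.
  by split=> //; apply: (divR_mono M_monster (f := id) sA sZ dphi dw _ dvphi).
have [kc [bs [bs0 indb incb]]] := dividing_sequence_from lchiP.
have [W [uW WP]] := type_ultra pglob.
pose D := (A `|` range b) `|` range (fun z : nat * J => bs z.1 z.2).
have sD : sm D.
  apply: (small_union M_monster); first by apply: (small_union M_monster) => //; apply: sm_range.
  by apply: sm_range; apply: (small_prod M_monster) => //; apply: (small_nat M_monster).
have [c cP] := realize M_monster sI sD uW.
have creal : realizes c (type_restr p D).
  move=> th [pt oth]; apply: (cP (fun c => holds c th)); first exact: over_dfn.
  by apply/WP => //; apply: over_mono oth.
have Wa S : dfn (A `|` range b) S -> S a -> W S.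
  move=> dS Sa; have [th oth thP] := dfn_over dS.
  have pth : p th by apply: pa; split=> //; apply/thP.
  have oth' : Defs.over setT th by apply: over_mono oth.
  by apply: (ultraS uW _ (iffLR (WP th oth') pth)) => x /thP.
have ac : eqv A a c.
  move=> S dS Sa; apply: cP; first by apply: dfn_mono dS => x Ax; left; left.
  by apply: Wa Sa; apply: dfn_mono dS => x; left.
have dflip C X Y (R : (X -> M) -> (Y -> M) -> Prop) : dfn2 C R -> dfn2 C (fun y x => R x y).
  by move=> dR; apply: (dfn2_sub (f := fun v => v \o inr) (g := fun v => v \o inl) _ _ dR); coords.
have Wb : W [set x | theta b x] by apply: Wa => //; apply: (dfn2_inst b (dflip _ _ _ _ dtheta)).
have dbs i : dfn D (fun x => theta (bs i) x).
  apply: dfn_mono (dfn2_inst (bs i) (dflip _ _ _ _ dtheta)) => x [Ax|[j _ <-]].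
    by left; left.
  by right; exists (i, j).
have tbs i : theta (bs i) c.
  apply: cP; first exact: dbs.
  (* Otherwise [theta] would separate [b] from [bs i], which lie in one [A]-indiscernible sequence,
     and [p] would split strongly. Strong splitting is about finite tuples, so only the coordinates
     on which [theta] depends are kept. *)
  apply: contrapT => /(ultraC _ uW) nW; apply: nsplit.
  have [lt ltP] := dfn_supp dtheta.
  pose lj := List.flat_map (fun z : J + I => if z is inl j then [:: j] else [::]) lt.
  pose g : 'I_(size lj) -> J := tnth (in_tuple lj).
  pose th (y : 'I_(size lj) -> M) (x : I -> M) := exists u, (forall e, u (g e) = y e) /\ theta u x.
  have thE u x : th (u \o g) x <-> theta u x.
    split=> [[u' [u'g]]|tu]; last by exists u.
    apply: (iffLR (ltP (join u' x) (join u x) _)) => -[j|k] //= jl.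
    have jlj : j \inl lj by apply/List.in_flat_map; exists (inl j); split=> //; left.
    have -> : j = g (Ordinal (pos_size jlj)) by rewrite /g (tnth_nth j) /= nth_pos.
    exact: u'g.
  have [psi psiP] : dfn2 A th.
    apply: (dfn2_ex (R := fun (v : 'I_(size lj) + I -> M) u => (forall e, u (g e) = (v \o inl) e) /\ theta u (v \o inr))).
    apply: dfn_and; first by apply: dfn_forall_fin => e; apply: dfn_eq.
    by apply: (dfn2_sub (f := fun v => v \o inr) (g := fun v => v \o inl \o inr) _ _ dtheta); coords.
  pose sh (z : ('I_(size lj) + I) + A) : I + ('I_(size lj) + A) := match z with
    | inl (inl e) => inr (inl e) | inl (inr k) => inl k | inr m => inr (inr m) end.
  have shP u x : holds x (inst (rename sh psi) (join (u \o g) val)) <-> theta u x.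
    rewrite holds_inst sat_rename -thE.
    have := psiP (join (u \o g) x); rewrite /= => ->.
    set v := _ \o sh; set w := join _ _.
    by suff -> : v = w by []; apply/funext => -[[]|].
  exists (size lj), (rename sh psi), (b \o g), (bs i \o g); split=> //.
    apply/WP; first by apply: over_and; [|apply: over_not]; apply: over_inst.
    apply: (ultraS uW _ (ultraI uW Wb nW)) => x [tb ntb]; apply/sat_and; split; first exact/shP.
    by apply/sat_not => /shP.
  exists (fun j => bs j \o g); split; last by exists 0, i; rewrite bs0.
  move=> n s t sh' th'; apply/tp_eqv.
  exact: (eqv_comp (f := fun z : 'I_n * 'I_(size lj) => (z.1, g z.2)) (indb n s t sh' th')).
(* With [kf * kc + 1] rows and [kf] values of [f], some value is taken on [kc] rows. *)
pose R := (kf * kc).+1.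
have Dbs (z : nat * J) : D (bs z.1 z.2) by right; exists z.
pose io z : D := SigSub (mem_set (Dbs z)).
pose row (x : D -> M) (i : nat) (j : J) := x (io (i, j)).
(* A property of [D] and [c] over [A], which therefore cannot divide. It records, for the first [R]
   rows, that [theta] holds and that the disjunction of [lchi] is [kc]-inconsistent along them. *)
pose rho (x : D -> M) (z : I -> M) := (forall i : 'I_R, theta (row x i) z) /\
  forall s : {ffun 'I_kc -> 'I_R}, injective s ->
    ~ exists y, forall e, exists2 chi, chi \inl lchi & chi y (row x (s e)).
have drow i : coordinatewise A (fun (v : D + I -> M) => row (v \o inl) i) by coords.
have drho : dfn2 A rho.
  apply: dfn_and.
    by apply: dfn_forall_fin => i; apply: (dfn2_sub (f := fun v => row (v \o inl) i)
      (g := fun v => v \o inr) _ _ dtheta); coords.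
  apply: dfn_forall_fin => s; apply: dfn_imp (dfn_cst _ _ _) _; apply: dfn_not.
  apply: (dfn2_ex (R := fun v y => forall e, exists2 chi, chi \inl lchi & chi y (row (v \o inl) (s e)))).
  apply: dfn_forall_fin => e.
  apply: (@dfn_exists_in _ _ _ _ _ lchi (fun Q v => Q (v \o inr) (row (v \o inl \o inl) (s e)))).
  move=> Q /lchiP [dQ _].
  by apply: (dfn2_sub (f := fun v => v \o inr) (g := fun v => row (v \o inl \o inl) (s e)) _ _ dQ); coords.
have rowE i : row val i = bs i by apply/funext.
have rhoc : rho val c.
  split=> [i|s si [y yP]]; first by rewrite rowE.
  apply: (incb (fun e => s e)); first by move=> e e' /val_inj /si.
  by exists y => e; have := yP e; rewrite rowE.
have ndiv : ~ divR A rho c.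
  move=> dv; have AbD : A `|` range b `<=` D by move=> x; left.
  apply: (pdiv D _ AbD c creal); first exact/smE.
  have [th dth thP] := divR_formula M_monster sA sI drho dv.
  exists th => //; apply: (tp_implies (dfn2_inst c drho) rhoc) => x rx.
  exact/thP.
apply: ndiv; exists kf, (fun j => es j \o inl); split=> [j|s si [x xP]].
  apply: eqv_trans (eqv_sym ac) _.
  exact: (eqv_comp (f := inl) (eqe j)).
have /choice[f fP] : forall i : 'I_R, exists e, exists2 chi, chi \inl lchi &
    chi (es (s e) \o inr) (row x i).
  (* A row satisfying no [chi] would, by the cover, satisfy some [phi] at each of the [kf] chosen
     terms, against [ince]. *)
  move=> i; apply: contrapT => nf; apply: (ince s si); exists (row x i) => e.
  have ti : theta (row x i) (es (s e) \o inl) by have [] := xP e.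
  have [[phi pl px]|hc] := (eqe (s e) _ dcover cov0) (row x i) ti.
    by exists (wide phi) => //; apply: List.in_map.
  by case: nf; exists e.
have [e0 [t [ti tf]]] := pigeonhole_fiber f.
have [_ xinc] := xP e0; apply: (xinc [ffun e => t e]).
  by move=> e e'; rewrite !ffunE => /ti.
exists (es (s e0) \o inr) => e; rewrite ffunE.
by have := fP (t e); rewrite tf.
Qed.

End Symmetry.

Theorem theorem7p5 (L : language) (T : set (sentence L))
    (T_complete : complete_theory T)
    (K : Type) (M : structure L) (M_monster : monster_model M K T)
    (T_NTP2 : NTP2 M)
    (A : set M) (A_small : small K A) (A_base : extension_base A)
    (I J : Type) (I_small : small K [set: I]) (J_small : small K [set: J])
    (a : I -> M) (b : J -> M) :
  ist K A a b -> st K A b a.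
Proof.
move=> istab.
have sA : sm K A by apply/smE.
have sI : sm K I by apply/sm_setT.
have sJ : sm K J by apply/sm_setT.
pose divl (E : set M) := [set phi : (J -> M) -> (E -> M) -> Prop | dfn2 A phi /\ divR A phi val].
pose divr (E : set M) := [set chi : (E -> M) -> (J -> M) -> Prop | dfn2 A chi /\ divR A chi b].
(* The conditions on the global type [q]: it extends the type of [b] over [A] and [a]; it contains
   no formula dividing over [A], which gives nonforking; and it contains no [chi val x] for which
   [chi y b] divides over [A], which will keep the type of [D] over [A] and [c] from dividing. *)
pose B := [set S : set (J -> M) | dfn (A `|` range a) S /\ S b] `|`
  [set P | exists E : set M, [/\ sm K E & exists2 phi, divl E phi & P = [set x | ~ phi x val]]] `|`
  [set P | exists E : set M, [/\ sm K E & exists2 chi, divr E chi & P = [set x | ~ chi val x]]].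
(* Finitely many conditions may mention different sets [E]; they are rewritten over one common small
   set, so that [ist_realizes] applies to a single tuple. *)
have liftl (E F : set M) l : sm K E -> E `<=` F -> (forall phi, phi \inl l -> divl E phi) ->
    exists l', (forall phi, phi \inl l' -> divl F phi) /\
      forall x, (forall phi, phi \inl l' -> ~ phi x val) -> forall phi, phi \inl l -> ~ phi x val.
  move=> sE EF lP; pose i (x : E) : F := SigSub (mem_set (EF _ (set_valP x))).
  have iE : val \o i = val by apply/funext.
  pose lift (phi : (J -> M) -> (E -> M) -> Prop) x (y : F -> M) := phi x (y \o i).
  exists (List.map lift l); split=> [_ /List.in_map_iff [phi [<- /lP [dphi dv]]]|x xl phi pl].
    have dl : dfn2 A (lift phi).
      by apply: (dfn2_sub (f := fun v => v \o inl) (g := fun v => v \o inr \o i) _ _ dphi); coords.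
    by split=> //; apply: (divR_mono M_monster (f := id) sA sE dphi dl _ dv) => x; rewrite /lift iE.
  by have := xl _ (List.in_map lift _ _ pl); rewrite /lift iE.
have liftr (E F : set M) l : E `<=` F -> (forall chi, chi \inl l -> divr E chi) ->
    exists l', (forall chi, chi \inl l' -> divr F chi) /\
      forall x, (forall chi, chi \inl l' -> ~ chi val x) -> forall chi, chi \inl l -> ~ chi val x.
  move=> EF lP; pose i (x : E) : F := SigSub (mem_set (EF _ (set_valP x))).
  have iE : val \o i = val by apply/funext.
  pose lift (chi : (E -> M) -> (J -> M) -> Prop) (x : F -> M) y := chi (x \o i) y.
  exists (List.map lift l); split=> [_ /List.in_map_iff [chi [<- /lP [dchi dv]]]|x xl chi cl].
    split; last exact: divR_comp.
    by apply: (dfn2_sub (f := fun v => v \o inl \o i) (g := fun v => v \o inr) _ _ dchi); coords.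
  by have := xl _ (List.in_map lift _ _ cl); rewrite /lift iE.
have [|W [uW BW]] := @fip_ultra _ B.
  move=> q qB.
  have [S [E [lphi [lchi [dS Sb [sE lphiP lchiP qP]]]]]] : exists S (E : set M) lphi lchi,
      [/\ dfn (A `|` range a) S, S b & [/\ sm K E, forall phi, phi \inl lphi -> divl E phi,
       forall chi, chi \inl lchi -> divr E chi &
       forall x, S x -> (forall phi, phi \inl lphi -> ~ phi x val) ->
         (forall chi, chi \inl lchi -> ~ chi val x) -> forall P, P \inl q -> P x]].
    elim: q qB => [|P q IH] qB.
      exists setT, A, [::], [::]; split=> //; apply: (dfn_cst _ J True).
    have [S [E [lphi [lchi [dS Sb [sE lphiP lchiP qP]]]]]] := IH (fun Q Ql => qB Q (or_intror Ql)).
    have [[[dP Pb]|[E' [sE' [R divR_ PR]]]]|[E' [sE' [R divR_ PR]]]] := qB P (or_introl erefl).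
      exists (S `&` P), E, lphi, lchi; split=> //; [exact: dfn_and|split=> //].
      by move=> x [Sx Px] xl xr Q [<-//|]; apply: qP.
    + have sF : sm K (E `|` E' : set M) := small_union M_monster sE sE'.
      have [l1 [l1P l1E]] := liftl _ _ lphi sE (@subsetUl _ E E') lphiP.
      have [l2 [l2P l2E]] := liftr _ _ lchi (@subsetUl _ E E') lchiP.
      have [|l3 [l3P l3E]] := liftl _ _ [:: R] sE' (@subsetUr _ E E').
        by move=> Q [<-|[]].
      exists S, (E `|` E'), (l3 ++ l1)%list, l2; split=> //; split=> //.
        by move=> phi pl; case: (List.in_app_or _ _ _ pl) => [/l3P|/l1P].
      move=> x Sx xl xr Q [<-|].
        rewrite PR; apply: (l3E x _ R (or_introl erefl)) => phi pl.
        by apply: xl; apply: List.in_or_app; left.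
      apply: qP => //; last exact: l2E.
      by apply: l1E => phi pl; apply: xl; apply: List.in_or_app; right.
    + have sF : sm K (E `|` E' : set M) := small_union M_monster sE sE'.
      have [l1 [l1P l1E]] := liftl _ _ lphi sE (@subsetUl _ E E') lphiP.
      have [l2 [l2P l2E]] := liftr _ _ lchi (@subsetUl _ E E') lchiP.
      have [|l3 [l3P l3E]] := liftr _ _ [:: R] (@subsetUr _ E E').
        by move=> Q [<-|[]].
      exists S, (E `|` E'), l1, (l3 ++ l2)%list; split=> //; split=> //.
        by move=> chi cl; case: (List.in_app_or _ _ _ cl) => [/l3P|/l2P].
      move=> x Sx xl xr Q [<-|].
        rewrite PR; apply: (l3E x _ R (or_introl erefl)) => chi cl.
        by apply: xr; apply: List.in_or_app; left.
      apply: qP => //; first exact: l1E.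
      by apply: l2E => chi cl; apply: xr; apply: List.in_or_app; right.
  have [theta dtheta thetaP] := dfn_abs dS.
  have [x [tx xl xr]] := ist_realizes M_monster T_NTP2 A_base sA sI sJ istab sE dtheta
    (iffLR (thetaP b) Sb) lphiP lchiP.
  by exists x; apply: qP => //; apply/thetaP.
have WdivE (E : set M) (phi : (J -> M) -> (E -> M) -> Prop) : sm K E -> divl E phi -> ~ W [set x | phi x val].
  by move=> sE dphi; apply/(ultraC _ uW); apply: BW; left; right; exists E; split=> //; exists phi.
pose q : set (formula L (J + M)) := [set theta | Defs.over setT theta /\ W [set c | holds c theta]].
exists q; split; first exact: ultra_type.
- move=> theta [oth hth]; split; first exact: over_mono oth.
  by apply: BW; left; left; split=> //; apply: over_dfn.
- move=> [n [theta [thdiv [m [eta [etaq etaP]]]]]].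
  have Weta := ultra_forall_fin uW (fun i => (etaq i).2).
  have Wn i : W [set c | ~ holds c (theta i)].
    apply/(ultraC _ uW) => Wt.
    have [k [phi [d [dphi dv phiE]]]] := formula_divides_divR (thdiv i).
    pose E : set M := range d; pose g (e : 'I_k) : E := SigSub (mem_set (imageT d e)).
    pose phi' x (y : E -> M) := phi x (y \o g).
    have dphi' : dfn2 A phi'.
      by apply: (dfn2_sub (f := fun v => v \o inl) (g := fun v => v \o inr \o g) _ _ dphi); coords.
    apply: (WdivE E phi').
    + by apply: sm_range; apply: (small_fin M_monster).
    + split=> //.
      by apply: (divR_mono M_monster (f := id) sA (small_fin M_monster (X := 'I_k)) dphi dphi' _ dv).
    + by apply: (ultraS uW _ Wt) => x /phiE.
  have [x [xeta xn]] := ultra_ex uW (ultraI uW Weta (ultra_forall_fin uW Wn)).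
  by have [i] := etaP x xeta; apply: xn.
- move=> D /smE sD AaD c creal [theta /formula_divides_divR [k [phi [d [dphi dv phiE]]]]].
  move=> /implies_tp [R [dR Rval Rtheta]].
  have [rho drho rhoE] := dfn_abs dR.
  (* The formula [rho val c] implies a dividing formula, so [rho] divides at [c], and also at its
     conjugate [b]; then [W] excludes [rho val x], although [c] realizes [q] over [D]. *)
  have dvc : divR A rho c.
    apply: (divR_mono M_monster (f := id) sA (small_fin M_monster (X := 'I_k)) dphi drho _ dv) => x.
    by move=> /rhoE /Rtheta /phiE.
  have cq S : dfn D S -> W S -> S c.
    move=> /dfn_over [th oth thP] WS; apply/thP; apply: creal; split=> //; split.
      exact: over_mono oth.
    by apply: (ultraS uW _ WS) => x /thP.
  have AD : A `<=` D by move=> x Ax; apply: AaD; left.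
  have bc : eqv A b c.
    move=> S dS Sb; apply: cq; first exact: dfn_mono dS.
    by apply: BW; left; left; split=> //; apply: dfn_mono dS => x; left.
  have Wn : W [set x | ~ rho val x].
    apply: BW; right; exists D; split=> //; exists rho => //; split=> //.
    exact: divR_eqv (eqv_sym bc) dvc.
  apply: (cq _ _ Wn); last exact/rhoE.
  have drho' : dfn2 A (fun y x => rho x y).
    by apply: (dfn2_sub (f := fun v => v \o inr) (g := fun v => v \o inl) _ _ drho); coords.
  apply: dfn_mono (dfn_not (dfn2_inst (val : D -> M) drho')) => x [/AD//|[z _ <-]].
  exact: set_valP.
Qed.
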